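(* Let $d,D$ be positive integers with $D\geq4d$, and let $\phi$, $\phi_{c}$, $F_{c}$, $K$, $K^{+}$, $a_{0}$ be as in the context (in particular satisfying all the standing assumptions listed there). Then, for Lebesgue-almost every $c$ in the open ball $\{c:\|c\|<a_{0}\}$, the delay map $F_{c}$ is immersive at every point of $K$, i.e. $dF_{c}(x)v\neq0$ for every $x\in K$ and every nonzero $v\in\mathbb{R}^{d}$; equivalently this holds with probability one relative to the ball $\|c\|<a_{0}$.
   Context: Notation: $\pi_{i}$ denotes projection of $\mathbb{R}^{d}$ onto the $i$-th coordinate and $\mathbf{e}_{1}=(1,0,\ldots,0)\in\mathbb{R}^{d}$. For a multi-index $\alpha\in\mathbb{Z}_{\geq0}^{d}$, $p_{\alpha}(x)=\prod_{i=1}^{d}(\pi_{i}x)^{\alpha_{i}}$ and $|\alpha|=\sum_i\alpha_i$. Let $\mathcal{I}_{2D-1}$ be the set of multi-indices with $|\alpha|\leq2D-1$ and $D_{\alpha}$ its cardinality; parameters are $c=(c_{\alpha})_{\alpha\in\mathcal{I}_{2D-1}}\in\mathbb{R}^{D_{\alpha}}$ with the Euclidean norm. Let $\phi:\mathbb{R}^{d}\to\mathbb{R}^{d}$ be a diffeomorphism and $\phi_{c}(x)=\phi(x)+\mathbf{e}_{1}\sum_{\alpha}c_{\alpha}p_{\alpha}(x)$. The delay map is $F_{c}(x)=(\pi_{1}x,\pi_{1}\phi_{c}(x),\ldots,\pi_{1}\phi_{c}^{D-1}(x))\in\mathbb{R}^{D}$. Standing assumptions: $K$ is a compact ball in $\mathbb{R}^{d}$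 centered at the origin; $K^{+}$ is a larger compact ball containing $K$ such that $\phi^{j}(x)\in K^{+}$ for $x\in K$, $0\leq j\leq D-1$; $a_{0}>0$ is so small that $\phi_{c}^{j}(x)\in K^{+}$ for all $x\in K$, $0\leq j\leq D-1$, $\|c\|\leq a_{0}$. Moreover, for every $\|c\|\leq a_{0}$: (1) $\phi_{c}$ is a $C^{3}$ diffeomorphism of $\mathbb{R}^{d}$; (2) $\phi_{c}$ has exactly $m$ fixed points $\xi_{1}(c),\ldots,\xi_{m}(c)$ (labelled consistently in $c$); (3) $\phi_{c}$ has no other periodic points of period less than $2D$; (4) all fixed points are hyperbolic and $\pi_{1}\xi_{i}(c)\neq\pi_{1}\xi_{j}(c)$ for $i\neq j$; (5) $F_{c}$ is immersive at each fixed point. ''Probability of $A$ relative to $B$'' means $\mu(A\cap B)/\mu(B)$, $\mu$ Lebesgue measure. *)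

(* Defs.v *)
From HB Require Import structures.
From mathcomp Require Import all_boot all_order all_algebra.
From mathcomp Require Import all_classical all_reals all_analysis.
From mathcomp Require Import complex.

Set Implicit Arguments.
Unset Strict Implicit.
Unset Printing Implicit Defensive.

Import Order.TTheory GRing.Theory Num.Theory.
Import numFieldNormedType.Exports.
Local Open Scope classical_set_scope.
Local Open Scope ring_scope.

Section Defs.
Variable R : realType.

(** Euclidean norm on R^n (the library norm on matrices is the max norm). *)
Definition enorm n (x : 'rV[R]_n) : R := Num.sqrt (\sum_(i < n) x 0 i ^+ 2).

Definition enormI (I : finType) (c : I -> R) : R := Num.sqrt (\sum_(i : I) c i ^+ 2).

Definition e1 n : 'rV[R]_n := \row_(i < n) ((val i == 0%N)%:R).
Definition pi1 n (x : 'rV[R]_n) : R := \sum_(i < n | val i == 0%N) x 0 i.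

Definition basis_vec n (i : 'I_n) : 'rV[R]_n := delta_mx 0 i.

Fixpoint Ck (k : nat) n m (f : 'rV[R]_n -> 'rV[R]_m) : Prop :=
  continuous f /\
  match k with
  | 0 => True
  | k'.+1 => forall i : 'I_n,
      (forall x, derivable f x (basis_vec i)) /\
      Ck k' (fun x => derive f x (basis_vec i))
  end.

Definition Ck_diffeo k n (f : 'rV[R]_n -> 'rV[R]_n) : Prop :=
  exists g : 'rV[R]_n -> 'rV[R]_n,
    cancel f g /\ cancel g f /\ Ck k f /\ Ck k g.

(** Jacobian matrix (row-vector convention: 'd f x v = v *m jacobian f x). *)
Definition jacobian n m (f : 'rV[R]_n -> 'rV[R]_m) (x : 'rV[R]_n) : 'M[R]_(n, m) :=
  \matrix_(i < n, j < m) ('d f x (basis_vec i)) 0 j.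

Definition hyperbolic_at n (f : 'rV[R]_n -> 'rV[R]_n) (x : 'rV[R]_n) : Prop :=
  differentiable f x /\
  forall a b : R, a ^+ 2 + b ^+ 2 = 1 ->
    \det ((@map_mx _ (complex.complex R) (fun r : R => complex.Complex r 0) n n
             (jacobian f x)) - (complex.Complex a b)%:M) != 0.

Definition immersive_at n m (F : 'rV[R]_n -> 'rV[R]_m) (x : 'rV[R]_n) : Prop :=
  differentiable F x /\ forall v : 'rV[R]_n, v != 0 -> 'd F x v != 0.

Definition box (I : finType) (lo hi : I -> R) : set (I -> R) :=
  [set c | forall i, lo i <= c i <= hi i].

Definition lebesgue_null (I : finType) (A : set (I -> R)) : Prop :=
  forall eps : R, 0 < eps ->
  exists lo hi : nat -> I -> R,
    (forall k i, lo k i <= hi k i) /\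
    A `<=` \bigcup_k box (lo k) (hi k) /\
    forall N, \sum_(k < N) \prod_(i : I) (hi k i - lo k i) <= eps.

End Defs.

Definition multi_index (d D : nat) :=
  {a : {ffun 'I_d -> 'I_(2 * D)} | (\sum_(i < d) (a i : nat) <= (2 * D).-1)%N}.

Section Delay.
Variable R : realType.
Variables d D : nat.

Definition monomial (a : multi_index d D) (x : 'rV[R]_d) : R :=
  \prod_(i < d) x 0 i ^+ (val a i : nat).

Definition perturb (phi : 'rV[R]_d -> 'rV[R]_d) (c : multi_index d D -> R)
  (x : 'rV[R]_d) : 'rV[R]_d :=
  phi x + (\sum_(a : multi_index d D) c a * monomial a x) *: e1 R d.

Definition delay_map (phi : 'rV[R]_d -> 'rV[R]_d) (c : multi_index d D -> R)
  (x : 'rV[R]_d) : 'rV[R]_D :=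
  \row_(j < D) pi1 (iter j (perturb phi c) x).

End Delay.

(* Main.v *)
Require Import Defs.
From HB Require Import structures.
From mathcomp Require Import all_boot all_order all_algebra.
From mathcomp Require Import all_classical all_reals all_analysis.
From mathcomp Require Import complex.
From mathcomp Require Import ring lra zify.
Import Order.TTheory GRing.Theory Num.Theory.
Import numFieldNormedType.Exports.
Local Open Scope classical_set_scope.
Local Open Scope ring_scope.

(** Let [Z] be the set of [(c, x, v)] with [v <> 0], [x] not fixed by [phi_c] and
    [dF_c(x) v = 0]; the bad parameters are the projection of [Z]. Write
    [(x_j, v_j)] for the orbit of [(x, v)] under the tangent map of [phi_c]. On [Z]
    every [pi_1 v_j] vanishes, so [v_(j+1)] is [dphi(x_j) v_j] with its first
    coordinate removed, which does not involve [c]. Comparing two points of [Z] near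
    [z0], with increment [e] of the parameter, the numbers [dP_e(x_j) v_j]
    ([j < D - 1], orbit of [z0]) are bounded by the increment of [(x, v)] and by the
    numbers [P_e(x_j)], up to [o(e)], where [P_e] is the polynomial with
    coefficients [e]. The [x_j] are distinct and the [v_j] nonzero, so by Hermite
    interpolation along a generic linear form there are polynomials of degree
    [< 2D] dual to the functionals [dP(x_j) v_j] and vanishing at all [x_j].
    Hence near [z0] the parameter is a Lipschitz function, on [Z], of [(x, v)] and
    of [N - (D - 1)] linear coordinates of the parameter, [N] being the number of
    multi-indices. As [2d < D - 1], the projection is covered by countably many
    Lipschitz images of subsets of a space of dimension less than [N], hence null. *)

Set Implicit Arguments.
Unset Strict Implicit.
Unset Printing Implicit Defensive.

(** * Lebesgue null sets and Lipschitz images of lower dimension *)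

Section NullSets.
Variables (R : realType) (I : finType).
Implicit Types (A B : set (I -> R)) (lo hi : I -> R).

Lemma lebesgue_null_sub A B : A `<=` B -> lebesgue_null B -> lebesgue_null A.
Proof.
move=> AB nB eps eps0; have [lo [hi [lohi [BU sumE]]]] := nB _ eps0.
by exists lo, hi; split => //; split => //; exact: subset_trans AB BU.
Qed.

Lemma geometric_half_sum_le (eps : R) n : 0 <= eps ->
  \sum_(i < n) eps / 2 ^+ i.+1 <= eps.
Proof.
move=> eps0; suff -> : \sum_(i < n) eps / 2 ^+ i.+1 = eps - eps / 2 ^+ n.
  by rewrite lerBlDr lerDl divr_ge0// exprn_ge0.
elim: n => [|n IHn]; first by rewrite big_ord0 expr0 divr1 subrr.
rewrite big_ord_recr/= IHn exprS; field.
by rewrite expf_neq0.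
Qed.

(** The set number [n] is covered with volume at most [eps / 2 ^+ n.+1], and the doubly indexed
    boxes are listed through [pickle] on pairs. *)
Lemma lebesgue_null_bigcup (i0 : I) (A : nat -> set (I -> R)) :
  (forall n, lebesgue_null (A n)) -> lebesgue_null (\bigcup_n A n).
Proof.
move=> nA eps eps0.
have /choice[b bP] : forall n, exists b : (nat -> I -> R) * (nat -> I -> R),
    [/\ forall k i, b.1 k i <= b.2 k i,
     A n `<=` \bigcup_k box (b.1 k) (b.2 k) &
     forall N, \sum_(k < N) \prod_i (b.2 k i - b.1 k i) <= eps / 2 ^+ n.+1].
  move=> n; have [|lo [hi [lohi [AU sumE]]]] := nA n (eps / 2 ^+ n.+1).
    by rewrite divr_gt0// exprn_gt0.
  by exists (lo, hi).
(* A number that codes no pair gets the box reduced to the origin; the factor at [i0] makes its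
   volume zero. *)
pose lo k := if @pickle_inv (nat * nat)%type k is Some p
  then (b p.1).1 p.2 else fun=> 0.
pose hi k := if @pickle_inv (nat * nat)%type k is Some p
  then (b p.1).2 p.2 else fun=> 0.
pose vol (p : nat * nat) := \prod_i ((b p.1).2 p.2 i - (b p.1).1 p.2 i).
have vol0 p : 0 <= vol p.
  by apply: prodr_ge0 => i _; rewrite subr_ge0; have [+ _ _] := bP p.1; exact.
exists lo, hi; split.
  move=> k i; rewrite /lo /hi; case: pickle_inv => [p|]//.
  by have [+ _ _] := bP p.1; exact.
split.
  move=> c [n _ Anc]; have [_ /(_ c Anc)[k _ ck] _] := bP n.
  by exists (pickle (n, k)) => //; rewrite /lo /hi pickleK_inv.
move=> N.
(* Every pair coded below [N] has both entries below [M], so a partial sum is at most a sum over an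
   [M] by [M] square. *)
pose M := (\max_(k < N)
  if @pickle_inv (nat * nat)%type k is Some p then (p.1 + p.2).+1 else 0)%N.
apply: (@le_trans _ _ (\sum_(k < N)
    \sum_(p : 'I_M * 'I_M | pickle (p.1 : nat, p.2 : nat) == k)
      vol (p.1 : nat, p.2 : nat))).
  apply: ler_sum => k _; rewrite /lo /hi.
  case E : (pickle_inv k : option (nat * nat)) => [[n m]|]; last first.
    rewrite (bigD1 i0)//= subrr mul0r.
    by apply: sumr_ge0 => p _; exact: vol0.
  have nmM : (n + m < M)%N.
    apply: leq_trans (leq_bigmax_cond (F := fun k : 'I_N =>
      if @pickle_inv (nat * nat)%type k is Some p then (p.1 + p.2).+1 else 0%N)
      (P := xpredT) k isT).
    by rewrite /= E.
  have nM : (n < M)%N by lia.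
  have mM : (m < M)%N by lia.
  rewrite (bigD1 (Ordinal nM, Ordinal mM))/=; last first.
    by have := @pickle_invK (nat * nat)%type k; rewrite /= E /= => ->.
  by rewrite lerDl; apply: sumr_ge0 => p _; exact: vol0.
rewrite (exchange_big_dep xpredT)//=.
apply: (@le_trans _ _ (\sum_(p : 'I_M * 'I_M) vol (p.1 : nat, p.2 : nat))).
  apply: ler_sum => p _; rewrite sumr_const.
  suff : (#|[pred i : 'I_N | pickle (p.1 : nat, p.2 : nat) == i]| <= 1)%N.
    case: (#|_|) => [|[|//]] _; first by rewrite mulr0n; exact: vol0.
    by rewrite mulr1n.
  by apply/card_le1_eqP => i j; rewrite !inE => /eqP-> /eqP/val_inj.
rewrite -(pair_bigA _ (fun n m : 'I_M => vol (n : nat, m : nat)))/=.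
apply: le_trans (geometric_half_sum_le M (ltW eps0)).
by apply: ler_sum => n _; have [_ _ +] := bP n; exact.
Qed.

(** The index [i0] gives degenerate boxes volume zero; over an empty [I] every box has volume 1, an
    empty product. *)
Lemma lebesgue_null0 (i0 : I) : lebesgue_null (set0 : set (I -> R)).
Proof.
move=> eps eps0; exists (fun _ _ => 0), (fun _ _ => 0); split => //; split => //.
move=> N; rewrite big1 ?(ltW eps0)// => k _.
by rewrite (bigD1 i0)//= subrr mul0r.
Qed.

Lemma lebesgue_null_bigcup_countable (i0 : I) (J : countType)
    (A : J -> set (I -> R)) :
  (forall j, lebesgue_null (A j)) -> lebesgue_null (\bigcup_j A j).
Proof.
move=> nA; pose B n := if @pickle_inv J n is Some j then A j else set0.
apply: (@lebesgue_null_sub _ (\bigcup_n B n)).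
  by move=> c [j _ Ajc]; exists (pickle j) => //; rewrite /B pickleK_inv.
apply: lebesgue_null_bigcup => // n; rewrite /B.
by case: pickle_inv => [j|]; [exact: nA|exact: lebesgue_null0].
Qed.

Lemma lebesgue_null_finite_cover (i0 : I) A :
  (forall eps : R, 0 < eps -> exists (J : finType) (lo hi : J -> I -> R),
    [/\ forall j i, lo j i <= hi j i,
        forall c, A c -> exists j, box (lo j) (hi j) c &
        \sum_j \prod_i (hi j i - lo j i) <= eps]) -> lebesgue_null A.
Proof.
move=> H eps eps0; have [J [lo [hi [lohi AU sumE]]]] := H _ eps0.
pose f (g : J -> I -> R) (k : nat) : I -> R :=
  if insub k is Some j then g (enum_val (j : 'I_#|J|)) else fun=> 0.
have fE g (j : 'I_#|J|) : f g j = g (enum_val j) by rewrite /f valK.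
exists (f lo), (f hi); split.
  by move=> k i; rewrite /f; case: insub.
split.
  move=> c /AU[j jc]; exists (enum_rank j) => //; rewrite !fE.
  by rewrite enum_rankK.
move=> N; apply: le_trans sumE.
have vol0 k : 0 <= \prod_i (f hi k i - f lo k i).
  by apply: prodr_ge0 => i _; rewrite subr_ge0 /f; case: insub.
rewrite [leRHS](reindex_onto (@enum_val J predT) enum_rank)/=; last first.
  by move=> j _; rewrite enum_rankK.
under [leRHS]eq_bigl => k do rewrite enum_valK eqxx.
under [leRHS]eq_bigr => k _ do rewrite -!fE.
rewrite -(big_mkord xpredT (fun k => \prod_i (f hi k i - f lo k i))).
rewrite -[leRHS](big_mkord xpredT (fun k => \prod_i (f hi k i - f lo k i))).
have [NJ|JN] := leqP N #|J|.
  by rewrite (big_cat_nat (leq0n N) NJ)//= lerDl sumr_ge0.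
rewrite (big_cat_nat (leq0n _) (ltnW JN))//= gerDl.
rewrite big_nat big1// => k /andP[Jk _].
by rewrite (bigD1 i0)//= /f insubF ?subrr ?mul0r// ltnNge Jk.
Qed.

(** [h] maps [E] into a cube of dimension [q] and side [2 * M]. Cut it into about [N ^+ q] cells of
    side [t = 2 * M / N]: points over one cell have parameters in a box of side [2 * C * t], and the
    total volume is of order [N ^+ q / N ^+ #|I|], which tends to 0. *)
Lemma lebesgue_null_lipschitz_graph (i0 : I) (X : Type) (E : set X) (q : nat)
    (c : X -> I -> R) (h : X -> 'I_q -> R) (M C : R) :
  (q < #|I|)%N ->
  (forall z z', E z -> E z' -> forall k, `|h z k - h z' k| <= M) ->
  (forall z z' t, 0 <= t -> E z -> E z' -> (forall k, `|h z k - h z' k| <= t) ->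
    forall i, `|c z i - c z' i| <= C * t) ->
  lebesgue_null (c @` E).
Proof.
move=> qI hM hC.
have [[z0 Ez0]|E0] := pselect (exists z, E z); last first.
  apply: lebesgue_null_sub (lebesgue_null0 i0).
  by move=> y [z Ez _]; apply: E0; exists z.
wlog [M0 C0] : M C hM hC / 0 < M /\ 0 < C.
  move=> /(_ (`|M| + 1) (`|C| + 1)); apply.
  - move=> z z' Ez Ez' k; apply: (le_trans (hM _ _ Ez Ez' k)).
    by rewrite (le_trans (ler_norm M))// lerDl.
  - move=> z z' t t0 Ez Ez' hk i.
    have := hC z z' t t0 Ez Ez' hk i => /le_trans; apply.
    by rewrite ler_wpM2r// (le_trans (ler_norm C))// lerDl.
  - by split; rewrite ltr_wpDl.
apply: (lebesgue_null_finite_cover i0) => eps eps0.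
(* Since [q < #|I|], the total volume is at most [K * eps / N], so it suffices that [N] exceed
   [K]. *)
pose K := 2 ^+ q * (4 * C * M) ^+ #|I| / eps.
have K0 : 0 <= K.
  by rewrite divr_ge0 ?mulr_ge0 ?exprn_ge0// ?mulr_ge0 ?(ltW C0) ?(ltW M0)// ltW.
have [n Kn] : exists n : nat, K < n.+1%:R.
  by exists (Num.truncn K); have /andP[] := truncn_itv K0.
pose N := n.+1%:R : R.
have N0 : 0 < N by rewrite ltr0n.
pose t := 2 * M / N.
have t0 : 0 < t by rewrite divr_gt0// mulr_gt0.
pose y z k := (h z k - h z0 k + M) / t.
have y0 z k : E z -> 0 <= y z k.
  move=> Ez; rewrite divr_ge0 ?(ltW t0)//.
  by have := hM _ _ Ez Ez0 k; rewrite ler_norml; lra.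
have yN z k : E z -> (Num.truncn (y z k) < n.+2)%N.
  move=> Ez; rewrite ltnS -(ler_nat R).
  apply: le_trans (_ : y z k <= _).
    by have /andP[] := truncn_itv (y0 z k Ez).
  rewrite ler_pdivrMr// /t mulrCA divff ?gt_eqF// mulr1.
  by have := hM _ _ Ez Ez0 k; rewrite ler_norml; lra.
(* [y z k] ranges over the closed interval from 0 to [n.+1]; its right endpoint needs one extra
   cell, hence [n.+2]. *)
pose cell z : {ffun 'I_q -> 'I_n.+2} := [ffun k => inord (Num.truncn (y z k))].
have cellP z z' : E z -> E z' -> cell z = cell z' ->
    forall k, `|h z k - h z' k| <= t.
  move=> Ez Ez' /ffunP ezz' k; have := ezz' k; rewrite !ffunE.
  move=> /(congr1 val); rewrite /= !inordK ?yN// => eyy.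
  have := truncn_itv (y0 z k Ez); have := truncn_itv (y0 z' k Ez').
  rewrite eyy -natr1 => /andP[h1 h2] /andP[h3 h4].
  have -> : h z k - h z' k = (y z k - y z' k) * t.
    by rewrite /y -mulrBl divfK ?gt_eqF//; ring.
  rewrite normrM (gtr0_norm t0) ler_piMl ?(ltW t0)// ler_norml.
  lra.
(* One representative per inhabited cell; an empty cell gets the default [z0]. *)
have /choice[rep repP] : forall j, exists z, E z /\
    ((exists2 z', E z' & cell z' = j) -> cell z = j).
  move=> j; have [[z' Ez' zj]|nj] := pselect (exists2 z', E z' & cell z' = j).
    by exists z'; split.
  by exists z0; split.
exists {ffun 'I_q -> 'I_n.+2}, (fun j i => c (rep j) i - C * t),
  (fun j i => c (rep j) i + C * t); split.
- by move=> j i; have := mulr_gt0 C0 t0; lra.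
- move=> _ [z Ez <-]; exists (cell z) => i.
  have [Er /(_ (ex_intro2 _ _ z Ez erefl)) er] := repP (cell z).
  have := hC z (rep (cell z)) t (ltW t0) Ez Er (cellP _ _ Ez Er (esym er)) i.
  by rewrite ler_norml; lra.
- rewrite (eq_bigr (fun=> (4 * C * M / N) ^+ #|I|)); last first.
    move=> j _; rewrite (eq_bigr (fun=> 4 * C * M / N)) ?prodr_const// => i _.
    by rewrite /t; field; rewrite gt_eqF.
  rewrite sumr_const -[_ *+ #|_|]mulr_natl (_ : #|_| = n.+2 ^ q)%N; last first.
    by rewrite -[LHS]/(#|{: {ffun _ -> _}}|) card_ffun !card_ord.
  rewrite natrX.
  have n2 : n.+2%:R <= 2 * N :> R by rewrite -natrM ler_nat; lia.
  apply: (@le_trans _ _ ((2 * N) ^+ q * (4 * C * M / N) ^+ #|I|)).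
    by rewrite ler_wpM2r ?lerXn2r ?nnegrE ?exprn_ge0// ?divr_ge0 ?mulr_ge0 ?ltW.
  move: Kn; rewrite /K ltr_pdivrMr// -/N => KN.
  apply: (@le_trans _ _ (2 ^+ q * (4 * C * M) ^+ #|I| / N)); last first.
    by rewrite ler_pdivrMr// [eps * _]mulrC ltW.
  rewrite (exprMn _ 2 N) (exprMn _ (4 * C * M)) exprVn mulrACA.
  rewrite ler_wpM2l ?mulr_ge0 ?exprn_ge0 ?mulr_ge0 ?(ltW C0) ?(ltW M0)//.
  have -> : #|I| = (q + (#|I| - q.+1).+1)%N by lia.
  rewrite exprD invfM mulrA divff ?expf_neq0 ?gt_eqF// mul1r exprS invfM.
  rewrite ler_piMr ?invr_ge0 ?(ltW N0)// invf_le1 ?exprn_gt0//.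
  by rewrite exprn_ege1// ler1n.
Qed.

(** Countability comes from grids in the coordinates [co]: each mesh [1 / n.+1] has countably many
    cells, and only those carrying a uniform estimate are kept. Each point lies in a kept cell once
    the mesh is below its radius [d]. *)
Lemma lebesgue_null_local_lipschitz_graph (i0 : I) (X : Type) (Z : set X)
    (K : finType) (co : X -> K -> R) (c : X -> I -> R) (q : nat) :
  (q < #|I|)%N ->
  (forall z0, Z z0 -> exists (d : R) (h : X -> 'I_q -> R) (M C : R), 0 < d /\
     forall z z', Z z -> Z z' ->
       (forall k, `|co z k - co z0 k| < d) ->
       (forall k, `|co z' k - co z0 k| < d) ->
       (forall k, `|h z k - h z' k| <= M) /\
       (forall t, 0 <= t -> (forall k, `|h z k - h z' k| <= t) ->
          forall i, `|c z i - c z' i| <= C * t)) ->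
  lebesgue_null (c @` Z).
Proof.
move=> qI loc.
pose cell n z : {ffun K -> int} := [ffun k => Num.floor (co z k * n.+1%:R)].
pose good n (kk : {ffun K -> int}) :=
  exists (h : X -> 'I_q -> R) (M C : R), forall z z', Z z -> Z z' ->
    cell n z = kk -> cell n z' = kk ->
    (forall k, `|h z k - h z' k| <= M) /\
    (forall t, 0 <= t -> (forall k, `|h z k - h z' k| <= t) ->
          forall i, `|c z i - c z' i| <= C * t).
pose E (j : nat * {ffun K -> int}) :=
  [set z | [/\ Z z, cell j.1 z = j.2 & good j.1 j.2]].
apply: (@lebesgue_null_sub _ (\bigcup_j (c @` E j))); last first.
  apply: lebesgue_null_bigcup_countable => // -[n kk].
  have [[h [M [C gd]]]|ngd] := pselect (good n kk); last first.
    apply: lebesgue_null_sub (lebesgue_null0 i0).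
    by move=> y [z [_ _ /ngd]].
  apply: (@lebesgue_null_lipschitz_graph i0 _ _ q c h M C) => //.
    by move=> z z' [/= Zz cz _] [/= Zz' cz' _]; have [] := gd z z' Zz Zz' cz cz'.
  move=> z z' t t0 [/= Zz cz _] [/= Zz' cz' _].
  by have [_ +] := gd z z' Zz Zz' cz cz'; apply.
move=> _ [z0 Zz0 <-].
have [d [h [M [C [d0 gd]]]]] := loc _ Zz0.
have dV0 : 0 <= d^-1 by rewrite invr_ge0 ltW.
pose n := Num.truncn d^-1.
have nd : n.+1%:R^-1 < d.
  by rewrite invf_plt ?posrE//; have /andP[] := truncn_itv dV0.
have cellP z z' : cell n z = cell n z' -> forall k, `|co z k - co z' k| < d.
  move=> /ffunP ezz' k; have := ezz' k; rewrite !ffunE => e; apply: lt_trans nd.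
  have := floor_itv (co z k * n.+1%:R); have := floor_itv (co z' k * n.+1%:R).
  rewrite e intrD => /andP[h1 h2] /andP[h3 h4].
  rewrite -[ltRHS]mul1r ltr_pdivlMr// -[X in _ * X]ger0_norm// -normrM.
  by rewrite ltr_norml mulrBl; lra.
exists (n, cell n z0) => //; exists z0 => //; split => //=.
exists h, M, C => z z' Zz Zz' cz cz'.
by apply: gd => // k; apply: cellP.
Qed.

End NullSets.

(** * Strict differentiability of continuously differentiable maps *)

Section Calculus.
Variable R : realType.

Lemma coord_le_norm n (x : 'rV[R]_n) i : `|x 0 i| <= `|x|.
Proof.
by rewrite [leRHS]/Num.Def.normr/= mx_normrE; exact: (le_bigmax _ _ (0, i)).
Qed.

Lemma norm_le_coord n (x : 'rV[R]_n) (e : R) :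
  0 <= e -> (forall i, `|x 0 i| <= e) -> `|x| <= e.
Proof.
move=> e0 xe; rewrite /Num.Def.normr/= mx_normrE; apply: bigmax_le => // -[i j] _.
by rewrite (ord1 i).
Qed.

Lemma mulmx_norm_le m n (A : 'M[R]_(m, n)) :
  exists2 C : R, 0 < C & forall x : 'rV[R]_m, `|x *m A| <= C * `|x|.
Proof.
have S0 : 0 <= \sum_i \sum_j `|A i j|.
  by apply: sumr_ge0 => i _; exact: sumr_ge0.
exists (1 + \sum_i \sum_j `|A i j|); first by rewrite ltr_wpDr.
move=> x; apply: norm_le_coord => [|j]; first by rewrite mulr_ge0// addr_ge0.
rewrite mxE (le_trans (ler_norm_sum _ _ _))//.
rewrite mulrDl mul1r ler_wpDl// mulr_suml; apply: ler_sum => i _.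
rewrite normrM mulrC ler_pM ?coord_le_norm//.
by rewrite (bigD1 j)//= lerDl sumr_ge0.
Qed.

Lemma mulmx_continuous m n (A : 'M[R]_(m, n)) :
  continuous (mulmxr A : {linear 'rV[R]_m -> 'rV[R]_n}).
Proof.
have [C C0 CA] := mulmx_norm_le A.
apply: bounded_linear_continuous; apply/linear_boundedP; exists C; split.
  exact: gtr0_real.
move=> M CM x; rewrite (le_trans (CA x))// ler_wpM2r// ltW//.
Qed.

Lemma increment_le (g dg : R -> R) (p q a eps : R) : p <= q ->
  (forall t : R, is_derive t (1 : R) g (dg t)) ->
  (forall t, p <= t <= q -> `|dg t - a| <= eps) ->
  `|g q - g p - (q - p) * a| <= eps * (q - p).
Proof.
move=> pq dgP dga.
have [|t] := @MVT_segment R g dg p q pq (fun x _ => dgP x).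
  by apply: derivable_within_continuous => t _; have [] := dgP t.
rewrite in_itv/= => ptq ->; rewrite mulrC -mulrBr normrM mulrC.
by rewrite [`|q - p|]ger0_norm ?subr_ge0// ler_wpM2r ?subr_ge0 ?dga.
Qed.

Lemma is_derive_line n (f : 'rV[R]_n -> R) (y e : 'rV[R]_n) (t : R) :
  derivable f (t *: e + y) e ->
  is_derive t (1 : R) (fun s => f (s *: e + y)) (derive f (t *: e + y) e).
Proof.
move=> fe; have E : (fun h : R => h^-1 *: (((fun s : R => f (s *: e + y)) \o shift t)
    (h *: (1 : R)) - f (t *: e + y))) =
  (fun h : R => h^-1 *: ((f \o shift (t *: e + y)) (h *: e) - f (t *: e + y))).
  apply/funext => h /=; congr (_ *: (f _ - _)).
  by rewrite scalerDl addrA; congr (_ *: _ + _ + _); rewrite /GRing.scale/= mulr1.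
by split; rewrite /derivable /derive E.
Qed.

(** Pass from [z] to [x] by changing one coordinate at a time and apply the mean value theorem on
    each leg. The legs stay in the ball because the norm is the maximum norm. *)
Lemma partial_increment_le n (f : 'rV[R]_n -> R) (x0 : 'rV[R]_n) (r eps : R)
    (a : 'I_n -> R) :
  (forall i x, derivable f x (basis_vec R i)) ->
  (forall i x, `|x - x0| < r -> `|derive f x (basis_vec R i) - a i| <= eps) ->
  forall x z, `|x - x0| < r -> `|z - x0| < r ->
    `|f x - f z - \sum_i (x 0 i - z 0 i) * a i| <= n%:R * eps * `|x - z|.
Proof.
move=> df dfa x z xr zr.
pose y (k : nat) : 'rV[R]_n := \row_i (if (i < k)%N then x 0 i else z 0 i).
have y0 : y 0 = z by apply/rowP => i; rewrite mxE ltn0.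
have yn : y n = x by apply/rowP => i; rewrite mxE ltn_ord.
have -> : f x - f z = \sum_(k < n) (f (y k.+1) - f (y k)).
  rewrite -(big_mkord xpredT (fun k => f (y k.+1) - f (y k))).
  by rewrite telescope_sumr// yn y0.
rewrite -sumrB (le_trans (ler_norm_sum _ _ _))//.
rewrite -mulrA mulr_natl -[X in _ *+ X]card_ord -sumr_const.
apply: ler_sum => k _.
have yS : y k.+1 = (x 0 k - z 0 k) *: basis_vec R k + y k.
  apply/rowP => i; rewrite !mxE ltnS leq_eqVlt.
  have [->|ik] := eqVneq i k; first by rewrite !eqxx ltnn/= mulr1 subrK.
  by rewrite andbF mulr0 add0r val_eqE (negPf ik).
pose g t := f (t *: basis_vec R k + y k).
pose dg t := derive f (t *: basis_vec R k + y k) (basis_vec R k).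
have gP (t : R) : is_derive t (1 : R) g (dg t) by apply: is_derive_line; exact: df.
have g0 : f (y k) = g 0 by rewrite /g scale0r add0r.
have bnd t : (z 0 k <= z 0 k + t <= x 0 k) || (x 0 k <= z 0 k + t <= z 0 k) ->
    `|dg t - a k| <= eps.
  move=> ht; apply: dfa; apply: (@le_lt_trans _ _ (Num.max `|x - x0| `|z - x0|)).
    apply: norm_le_coord => [|i]; first by rewrite le_max normr_ge0.
    have := coord_le_norm (x - x0) i; have := coord_le_norm (z - x0) i.
    rewrite !mxE le_max !ler_norml => /andP[z1 z2] /andP[x1 x2].
    have [->|ik] := eqVneq i k.
      rewrite eqxx ltnn/= mulr1.
      move: (coord_le_norm (x - x0) k) (coord_le_norm (z - x0) k).
      rewrite !mxE !ler_norml => /andP[x3 x4] /andP[z3 z4].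
      by have [w0|w0] := leP 0 (t + z 0 k - x0 0 k);
        case/orP: ht => /andP[t1 t2]; apply/orP; (left + right); lra.
    rewrite andbF mulr0 add0r.
    by case: ifP => _; rewrite ?x1 ?z1 ?x2 ?z2 ?orbT.
  by rewrite gt_max xr.
have xzk := coord_le_norm (x - z) k; rewrite !mxE in xzk.
have [eps0|] := ltP eps 0.
  by have := dfa k x xr; have := normr_ge0 (derive f x (basis_vec R k) - a k); lra.
move=> eps0; rewrite yS g0 -/(g _); have [h|h] := leP 0 (x 0 k - z 0 k).
  have := @increment_le g dg 0 (x 0 k - z 0 k) (a k) eps h gP.
  rewrite !subr0 => /(_ _)/le_trans; apply.
    by move=> t ht; apply: bnd; apply/orP; left; lra.
  by rewrite ler_wpM2l//; apply: le_trans xzk; exact: ler_norm.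
have := @increment_le g dg (x 0 k - z 0 k) 0 (a k) eps (ltW h) gP.
rewrite -normrN sub0r => H; apply: le_trans (le_trans _ (H _)) _.
- by rewrite le_eqVlt; apply/orP; left; apply/eqP; congr (`|_|); ring.
- by move=> t ht; apply: bnd; apply/orP; right; lra.
- rewrite ler_wpM2l//; apply: le_trans xzk.
  by rewrite -normrN; exact: ler_norm.
Qed.

Lemma near_normP (V : normedModType R) (x : V) (P : set V) :
  (\forall y \near x, P y) ->
  exists2 d : R, 0 < d & forall y, `|y - x| < d -> P y.
Proof.
move=> /nbhs_ballP[d d0 dP]; exists d => // y yx; apply: dP.
by rewrite -ball_normE /= distrC.
Qed.

(** Built from directional derivatives, the data [Ck] provides, so that it can be used before
    differentiability is known. *)
Definition partials n m (f : 'rV[R]_n -> 'rV[R]_m) (x : 'rV[R]_n) : 'M[R]_(n, m) :=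
  \matrix_(i, j) derive f x (basis_vec R i) 0 j.

(** Continuity makes the partial derivatives nearly constant near [x0]. Both points vary, which
    yields Lipschitz estimates as well as the differential. *)
Lemma Ck_strictly_differentiable k n m (f : 'rV[R]_n -> 'rV[R]_m)
    (x0 : 'rV[R]_n) (eps : R) : Ck k.+1 f -> 0 < eps ->
  exists2 d : R, 0 < d & forall x z, `|x - x0| < d -> `|z - x0| < d ->
    `|f x - f z - (x - z) *m partials f x0| <= eps * `|x - z|.
Proof.
move=> [_ Cf] eps0; pose e := eps / n.+1%:R.
have e0 : 0 < e by rewrite divr_gt0.
have /near_normP[d d0 dP] : \forall x \near x0, forall i : 'I_n,
    `|derive f x0 (basis_vec R i) - derive f x (basis_vec R i)| <= e.
  near=> x; near: x; apply: filter_forall => i; have [_ Ci] := Cf i.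
  have Cc : continuous (fun x => derive f x (basis_vec R i)).
    by case: k {Cf} Ci => [|k] [].
  by have /cvgrPdist_le := Cc x0; exact.
exists d => // x z xd zd; apply: norm_le_coord => [|j].
  by rewrite mulr_ge0// ltW.
have dfj i y : derivable (fun x => f x 0 j) y (basis_vec R i).
  by have [/(_ y)/derivable_mxP/(_ 0 j)] := Cf i.
have -> : (f x - f z - (x - z) *m partials f x0) 0 j =
    f x 0 j - f z 0 j - \sum_i (x 0 i - z 0 i) * partials f x0 i j.
  by rewrite !mxE; congr (_ - _); apply: eq_bigr => i _; rewrite !mxE.
apply: (le_trans (@partial_increment_le n (fun x => f x 0 j) x0 d e
  (fun i => partials f x0 i j) dfj _ x z xd zd)).
  move=> i y yd; rewrite mxE.
  have -> : derive (fun x => f x 0 j) y (basis_vec R i) =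
      derive f y (basis_vec R i) 0 j.
    by rewrite derive_mx ?mxE//; have [] := Cf i.
  apply: le_trans (dP y yd i); rewrite distrC.
  have := coord_le_norm (derive f x0 (basis_vec R i) - derive f y (basis_vec R i)) j.
  by rewrite [X in `|X| <= _ -> _]mxE [X in _ + X]mxE.
rewrite ler_wpM2r// /e mulrA ler_pdivrMr// mulrC ler_wpM2l ?(ltW eps0)//.
by rewrite ler_nat.
Unshelve. all: by end_near. Qed.

Lemma is_diff_linear_approx (V W : normedModType R) (f : V -> W) (x : V)
    (df : {linear V -> W}) : continuous df ->
  (forall eps : R, 0 < eps -> exists2 d : R, 0 < d & forall y, `|y - x| < d ->
     `|f y - f x - df (y - x)| <= eps * `|y - x|) ->
  is_diff x f df.
Proof.
move=> dfc H.
have E : f \o shift x = cst (f x) + df +o_ 0 id.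
  apply/eqaddoP => _/posnumP[eps].
  have [d d0 dP] := H _ (gt0 eps); apply/nbhs_ballP; exists d => //= h.
  rewrite -ball_normE/= sub0r normrN => hd.
  have := dP (h + x); rewrite addrK => /(_ hd).
  by rewrite -![(_ + _ : _ -> _) _]/(_ + _) -![(- _ : _ -> _) _]/(- _)/= opprD addrA.
have dE := diff_unique dfc E.
by split => //; apply/diff_locallyP; rewrite dE.
Qed.

Lemma Ck_is_diff k n m (f : 'rV[R]_n -> 'rV[R]_m) (x : 'rV[R]_n) :
  Ck k.+1 f -> is_diff x f (mulmxr (partials f x)).
Proof.
move=> Cf; apply: is_diff_linear_approx; first exact: mulmx_continuous.
move=> eps eps0; have [d d0 dP] := Ck_strictly_differentiable x Cf eps0.
by exists d => // y yx; apply: dP => //; rewrite subrr normr0.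
Qed.

End Calculus.

(** * Calculus of locally Lipschitz maps *)

Section LocallyLipschitz.
Variable R : realType.

Definition loclip (V W : normedModType R) (f : V -> W) (x : V) :=
  exists C d : R, [/\ 0 < C, 0 < d & forall y z,
    `|y - x| < d -> `|z - x| < d -> `|f y - f z| <= C * `|y - z|].

Lemma lipschitz_loclip (V W : normedModType R) (f : V -> W) (C : R) x :
  (forall y z, `|f y - f z| <= C * `|y - z|) -> loclip f x.
Proof.
move=> H; exists (`|C| + 1), 1; split => //.
move=> y z _ _; apply: (le_trans (H y z)); rewrite ler_wpM2r//.
by rewrite (le_trans (ler_norm C))// lerDl.
Qed.

Lemma loclip_cst (V W : normedModType R) (a : W) (x : V) : loclip (fun=> a) x.
Proof.
by apply: (@lipschitz_loclip _ _ _ 0) => y z; rewrite subrr normr0 mul0r.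
Qed.

Lemma normr_fst_le (V W : normedModType R) (z : V * W) : `|z.1| <= `|z|.
Proof. by rewrite [leRHS]prod_normE le_max lexx. Qed.

Lemma normr_snd_le (V W : normedModType R) (z : V * W) : `|z.2| <= `|z|.
Proof. by rewrite [leRHS]prod_normE le_max lexx orbT. Qed.

Lemma loclip_fst (V W : normedModType R) (z : V * W) : loclip fst z.
Proof.
apply: (@lipschitz_loclip _ _ _ 1) => y y'; rewrite mul1r.
exact: (normr_fst_le (y - y')).
Qed.

Lemma loclip_snd (V W : normedModType R) (z : V * W) : loclip snd z.
Proof.
apply: (@lipschitz_loclip _ _ _ 1) => y y'; rewrite mul1r.
exact: (normr_snd_le (y - y')).
Qed.

Lemma loclip_coord n i (x : 'rV[R]_n) : loclip (fun y : 'rV[R]_n => y 0 i) x.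
Proof.
apply: (@lipschitz_loclip _ _ _ 1) => y z; rewrite mul1r.
by have := coord_le_norm (y - z) i; rewrite !mxE.
Qed.

Lemma loclip_mulmx m n (A : 'M[R]_(m, n)) (x : 'rV[R]_m) :
  loclip (fun y : 'rV[R]_m => y *m A) x.
Proof.
have [C C0 CA] := mulmx_norm_le A.
by apply: (@lipschitz_loclip _ _ _ C) => y z; rewrite -mulmxBl.
Qed.

Lemma loclip_near (V W : normedModType R) (f : V -> W) x (e : R) :
  loclip f x -> 0 < e ->
  exists2 d : R, 0 < d & forall y, `|y - x| < d -> `|f y - f x| < e.
Proof.
move=> [C [d [C0 d0 H]]] e0; exists (Num.min d (e / C)).
  by rewrite lt_min d0 divr_gt0.
move=> y; rewrite lt_min => /andP[yd ye].
rewrite (le_lt_trans (H y x yd _))// ?subrr ?normr0//.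
by rewrite mulrC -ltr_pdivlMr.
Qed.

Lemma loclip_comp (U V W : normedModType R) (f : U -> V) (g : V -> W) x :
  loclip f x -> loclip g (f x) -> loclip (fun y => g (f y)) x.
Proof.
move=> lf [C [d [C0 d0 H]]]; have [r r0 rP] := loclip_near lf d0.
move: lf => [C' [d' [C'0 d'0 H']]].
exists (C * C'), (Num.min d' r); split; [exact: mulr_gt0|by rewrite lt_min d'0|].
move=> y z; rewrite !lt_min => /andP[yd yr] /andP[zd zr].
apply: (le_trans (H _ _ (rP _ yr) (rP _ zr))); rewrite -mulrA ler_wpM2l ?(ltW C0)//.
exact: H'.
Qed.

Lemma loclip_pair (U V W : normedModType R) (f : U -> V) (g : U -> W) x :
  loclip f x -> loclip g x -> loclip (fun y => (f y, g y)) x.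
Proof.
move=> [C [d [C0 d0 H]]] [C' [d' [C'0 d'0 H']]].
exists (C + C'), (Num.min d d'); split; [exact: addr_gt0|by rewrite lt_min d0|].
move=> y z; rewrite !lt_min => /andP[yd yd'] /andP[zd zd'].
rewrite prod_normE ge_max /= (le_trans (H y z yd zd)) ?(le_trans (H' y z yd' zd'))//.
  by rewrite ler_wpM2r// lerDr ltW.
by rewrite ler_wpM2r// lerDl ltW.
Qed.

Lemma loclipD (V W : normedModType R) (f g : V -> W) x :
  loclip f x -> loclip g x -> loclip (fun y => f y + g y) x.
Proof.
move=> [C [d [C0 d0 H]]] [C' [d' [C'0 d'0 H']]].
exists (C + C'), (Num.min d d'); split; [exact: addr_gt0|by rewrite lt_min d0|].
move=> y z; rewrite !lt_min => /andP[yd yd'] /andP[zd zd'].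
rewrite opprD addrACA mulrDl (le_trans (ler_normD _ _))// lerD//.
  exact: H.
exact: H'.
Qed.

Lemma loclip_sum (V W : normedModType R) (J : finType) (f : J -> V -> W) x :
  (forall j, loclip (f j) x) -> loclip (fun y => \sum_j f j y) x.
Proof.
move=> H; suff : forall s : seq J, loclip (fun y => \sum_(j <- s) f j y) x by exact.
elim=> [|j s IHs].
  rewrite (_ : (fun _ => _) = fun=> 0); first exact: loclip_cst.
  by apply/funext => y; rewrite big_nil.
rewrite (_ : (fun _ => _) = fun y => f j y + \sum_(j <- s) f j y).
  exact: loclipD.
by apply/funext => y; rewrite big_cons.
Qed.

Lemma loclipZ (V W : normedModType R) (k : V -> R) (f : V -> W) x :
  loclip k x -> loclip f x -> loclip (fun y => k y *: f y) x.
Proof.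
move=> lk lf; have [r r0 rP] := loclip_near lk ltr01.
have [s s0 sP] := loclip_near lf ltr01.
move: lk lf => [C [d [C0 d0 H]]] [C' [d' [C'0 d'0 H']]].
(* [K] and [F] bound [k] and [f] where each moves by less than 1. *)
pose K := `|k x| + 1; pose F := `|f x| + 1.
have K0 : 0 < K by rewrite ltr_wpDl.
have F0 : 0 < F by rewrite ltr_wpDl.
exists (C * F + K * C'), (Num.min (Num.min d d') (Num.min r s)); split.
- by rewrite addr_gt0// mulr_gt0.
- by rewrite !lt_min d0 d'0 r0 s0.
move=> y z; rewrite !lt_min => /andP[/andP[yd yd'] /andP[yr ys]].
move=> /andP[/andP[zd zd'] /andP[zr zs]].
have -> : k y *: f y - k z *: f z = (k y - k z) *: f z + k y *: (f y - f z).
  by rewrite scalerBl scalerBr [RHS]addrC addrA subrK.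
rewrite (le_trans (ler_normD _ _))// !normrZ mulrDl lerD//.
  rewrite mulrAC ler_pM ?H// -[f z](subrK (f x)) addrC.
  by rewrite (le_trans (ler_normD _ _))// lerD2l ltW ?sP.
rewrite -mulrA ler_pM ?H'// -[k y](subrK (k x)) addrC.
by rewrite (le_trans (ler_normD _ _))// lerD2l ltW ?rP.
Qed.

Lemma loclipM (V : normedModType R) (f g : V -> R) x :
  loclip f x -> loclip g x -> loclip (fun y => f y * g y) x.
Proof. exact: (@loclipZ V R). Qed.

Lemma Ck_loclip k n m (f : 'rV[R]_n -> 'rV[R]_m) x : Ck k.+1 f -> loclip f x.
Proof.
move=> Cf; have [d d0 dP] := Ck_strictly_differentiable x Cf ltr01.
have [C C0 CA] := mulmx_norm_le (partials f x).
exists (1 + C), d; split => //; first by rewrite addr_gt0.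
move=> y z yd zd; rewrite -[f y - f z](subrK ((y - z) *m partials f x)).
by rewrite (le_trans (ler_normD _ _))// mulrDl lerD ?CA ?dP.
Qed.

(** The tangent map is the sum of the [v_i] times the i-th partial derivatives, and those of a [C^2]
    map are locally Lipschitz. *)
Lemma Ck_loclip_tangent k n m (f : 'rV[R]_n -> 'rV[R]_m)
    (z : 'rV[R]_n * 'rV[R]_n) :
  Ck k.+2 f -> loclip (fun z => z.2 *m partials f z.1) z.
Proof.
move=> [_ Cf].
rewrite (_ : (fun _ => _) = fun z : 'rV[R]_n * 'rV[R]_n =>
    \sum_i z.2 0 i *: derive f z.1 (basis_vec R i)); last first.
  apply/funext => y; apply/rowP => j; rewrite mxE summxE.
  by apply: eq_bigr => i _; rewrite !mxE.
apply: loclip_sum => i; apply: loclipZ.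
  exact: (loclip_comp (loclip_snd z) (loclip_coord i _)).
apply: (@loclip_comp _ _ _ fst (fun x => derive f x (basis_vec R i))).
  exact: loclip_fst.
by have [_ Ci] := Cf i; exact: Ck_loclip Ci.
Qed.

End LocallyLipschitz.

Lemma is_diff_sum (R : realType) (V W : normedModType R) (J : finType)
    (f df : J -> V -> W) (x : V) : (forall j, is_diff x (f j) (df j)) ->
  is_diff x (fun y => \sum_j f j y) (fun v => \sum_j df j v).
Proof.
move=> H; suff : forall s : seq J, is_diff x (fun y => \sum_(j <- s) f j y)
  (fun v => \sum_(j <- s) df j v) by exact.
elim=> [|j s IHs].
  rewrite (_ : (fun _ => _) = cst 0); last by apply/funext => y; rewrite big_nil.
  rewrite [X in is_diff _ _ X](_ : _ = 0); first exact: is_diff_cst.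
  by apply/funext => y; rewrite big_nil.
rewrite (_ : (fun _ => _) = f j + (fun y => \sum_(j <- s) f j y)); last first.
  by apply/funext => y; rewrite big_cons.
rewrite [X in is_diff _ _ X](_ : _ = df j + (fun y => \sum_(j <- s) df j y)).
  exact: is_diffD.
by apply/funext => y; rewrite big_cons.
Qed.

(** * Functions with a locally Lipschitz tangent map *)

Section SmoothFunctions.
Variables (R : realType) (n : nat).
Implicit Type f : 'rV[R]_n -> R.

(** A stand-in for second order smoothness that is stable under products, and so reaches the
    monomials from the coordinate functions. *)
Definition tangent_lip f :=
  [/\ forall x, differentiable f x, forall x, loclip f x &
      forall z, loclip (fun z : 'rV[R]_n * 'rV[R]_n => 'd f (z.1) z.2 : R) z].

Lemma tangent_lip_cst (a : R) : tangent_lip (fun=> a).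
Proof.
split=> [x|x|z]; [exact: differentiable_cst|exact: loclip_cst|].
rewrite (_ : (fun _ => _) = fun=> 0); first exact: loclip_cst.
by apply/funext => y; exact: (congr1 (fun h => h y.2) (diff_cst a y.1)).
Qed.

Lemma is_diff_coord i (x : 'rV[R]_n) :
  is_diff x (fun x : 'rV[R]_n => x 0 i : R) (fun v => v 0 i).
Proof.
have lin : linear (fun x : 'rV[R]_n => x 0 i : R) by move=> a u v; rewrite !mxE.
pose linM := GRing.isLinear.Build _ _ _ _ _ lin.
pose linL : {linear 'rV[R]_n -> R} := HB.pack (fun x : 'rV[R]_n => x 0 i : R) linM.
split; first exact: differentiable_coord.
rewrite -[RHS]/(linL : _ -> _) -(@diff_lin R _ _ linL x)//.
exact: coord_continuous.
Qed.

Lemma tangent_lip_coord i : tangent_lip (fun x => x 0 i).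
Proof.
have D := is_diff_coord i.
split=> [x|x|z]; [exact: ex_diff|exact: loclip_coord|].
rewrite (_ : (fun _ => _) = fun z : 'rV[R]_n * 'rV[R]_n => z.2 0 i).
  exact: (loclip_comp (loclip_snd z) (loclip_coord i _)).
by apply/funext => y; exact: (congr1 (fun h => h y.2) (@diff_val _ _ _ _ _ _ _ (D y.1))).
Qed.

Lemma tangent_lipM f g :
  tangent_lip f -> tangent_lip g -> tangent_lip (fun x => f x * g x).
Proof.
move=> [df lf tf] [dg lg tg]; split=> [x|x|z].
- exact: differentiableM.
- exact: loclipM.
rewrite (_ : (fun _ => _) = fun z : 'rV[R]_n * 'rV[R]_n =>
    f z.1 * 'd g (z.1) z.2 + g z.1 * 'd f (z.1) z.2); last first.
  apply/funext => y; have := @diffM R _ f g y.1 (df _) (dg _).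
  by move=> /(congr1 (fun h => h y.2)).
apply: loclipD; apply: loclipM => //; exact: (loclip_comp (loclip_fst z)).
Qed.

Lemma tangent_lip_prod (J : finType) (f : J -> 'rV[R]_n -> R) :
  (forall j, tangent_lip (f j)) -> tangent_lip (fun x => \prod_j f j x).
Proof.
move=> H; suff : forall s : seq J, tangent_lip (fun x => \prod_(j <- s) f j x) by exact.
elim=> [|j s IHs].
  rewrite (_ : (fun _ => _) = fun=> 1); first exact: tangent_lip_cst.
  by apply/funext => y; rewrite big_nil.
rewrite (_ : (fun _ => _) = fun y => f j y * \prod_(j <- s) f j y).
  exact: tangent_lipM.
by apply/funext => y; rewrite big_cons.
Qed.

Lemma tangent_lipX f k : tangent_lip f -> tangent_lip (fun x => f x ^+ k).
Proof.
move=> H; elim: k => [|k IHk]; first exact: tangent_lip_cst.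
rewrite (_ : (fun _ => _) = fun x => f x * f x ^+ k); first exact: tangent_lipM.
by apply/funext => y; rewrite exprS.
Qed.

End SmoothFunctions.

(** * Polynomials in the span of the available monomials *)

Section MonomialSpan.
Variables (R : realType) (d D : nat).
Hypothesis D0 : (0 < D)%N.
Local Notation I := (multi_index d D).
Implicit Type a b : I.

Definition mdeg a : nat := (\sum_(i < d) (val a i : nat))%N.

Definition poly_eval (c : I -> R) (x : 'rV[R]_d) := \sum_a c a * monomial a x.

(** Polynomial functions of degree at most [k]; the bound is tracked so that products with linear
    forms stay within the available multi-indices. *)
Definition spanned k (f : 'rV[R]_d -> R) := exists c : I -> R,
  (forall a, (k < mdeg a)%N -> c a = 0) /\ (forall x, f x = poly_eval c x).

(** The alternative [h j = 0] tolerates terms of too high degree whose coefficient vanishes. *)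
Lemma spanned_sum (J : finType) k (f : J -> 'rV[R]_d -> R) (h : J -> R) :
  (forall j, spanned k (f j) \/ h j = 0) -> spanned k (fun x => \sum_j h j * f j x).
Proof.
move=> H; have /choice[c cP] : forall j, exists c : I -> R,
    (forall a, (k < mdeg a)%N -> c a = 0) /\
    (forall x, h j * f j x = h j * poly_eval c x).
  move=> j; have [[c [c1 c2]]|->] := H j.
    by exists c; split=> // x; rewrite c2.
  by exists (fun=> 0); split=> // x; rewrite !mul0r.
exists (fun a => \sum_j h j * c j a); split.
  move=> a ka; apply: big1 => j _.
  by have [-> //] := cP j; rewrite mulr0.
move=> x; rewrite /poly_eval; under [RHS]eq_bigr do rewrite mulr_suml.
rewrite exchange_big/=; apply: eq_bigr => j _.
have [_ ->] := cP j; rewrite mulr_sumr; apply: eq_bigr => a _.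
by rewrite mulrA.
Qed.

Lemma spanned_monomial k b : (mdeg b <= k)%N -> spanned k (monomial b).
Proof.
move=> bk; exists (fun a => (a == b)%:R); split.
  by move=> a; have [->|//] := eqVneq a b; rewrite ltnNge bk.
move=> x; rewrite /poly_eval (bigD1 b)//= eqxx mul1r big1 ?addr0// => a ab.
by rewrite (negPf ab) mul0r.
Qed.

Lemma exists_mdeg0 : exists a, mdeg a = 0%N.
Proof.
have D20 : (0 < 2 * D)%N by rewrite muln_gt0.
pose z : {ffun 'I_d -> 'I_(2 * D)} := [ffun=> Ordinal D20].
have z0 : (\sum_(i < d) (z i : nat) = 0)%N by apply: big1 => i _; rewrite ffunE.
have zP : (\sum_(i < d) (z i : nat) <= (2 * D).-1)%N by rewrite z0.
by exists (exist _ z zP).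
Qed.

Lemma spanned_cst k (r : R) : spanned k (fun=> r).
Proof.
have [a a0] := exists_mdeg0.
have [c [c1 c2]] : spanned k (monomial a) by apply: spanned_monomial; rewrite a0.
exists (fun a => r * c a); split; first by move=> b /c1->; rewrite mulr0.
move=> x; rewrite /poly_eval; under eq_bigr do rewrite -mulrA.
rewrite -mulr_sumr -/(poly_eval c x) -c2 /monomial big1 ?mulr1// => i _.
by move/eqP: a0; rewrite sum_nat_eq0 => /forallP/(_ i)/eqP ->.
Qed.

Lemma spannedD k f g : spanned k f -> spanned k g -> spanned k (fun x => f x + g x).
Proof.
move=> Sf Sg; have [|c [c1 c2]] :=
    @spanned_sum bool k (fun t : bool => if t then f else g) (fun=> 1).
  by case; left.
by exists c; split => // x; rewrite -c2 big_bool/= !mul1r.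
Qed.

Lemma spanned_mul_coord k f (i : 'I_d) : (k.+1 < 2 * D)%N ->
  spanned k f -> spanned k.+1 (fun x => x 0 i * f x).
Proof.
move=> kD [c [c1 c2]].
have [|c' [c'1 c'2]] :=
    @spanned_sum I k.+1 (fun a x => x 0 i * monomial a x) c.
  move=> a; have [ak|/c1] := leqP (mdeg a) k; [left|by right].
  (* The default of [insubd] is never taken: [k.+1 < 2 * D] keeps the raised exponent in range, as
     [bE] records. *)
  pose b : {ffun 'I_d -> 'I_(2 * D)} :=
    [ffun j => insubd (val a j) ((val a j : nat) + (j == i))%N].
  have aE : mdeg a = (val a i + \sum_(j < d | j != i) (val a j : nat))%N.
    by rewrite /mdeg (bigD1 i).
  have bE j : b j = (val a j + (j == i))%N :> nat.
    rewrite ffunE val_insubd; case: ifP => //.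
    have [->|ji] := eqVneq j i; last by rewrite addn0 ltn_ord.
    by rewrite addn1 => /negP; case; lia.
  have bdeg : (\sum_(j < d) (b j : nat) = (mdeg a).+1)%N.
    rewrite (eq_bigr _ (fun j _ => bE j)) big_split/= -/(mdeg a).
    rewrite [X in (_ + X)%N](bigD1 i)//= eqxx big1 ?addn0 ?addn1// => j.
    by move=> /negPf->.
  have bP : (\sum_(j < d) (b j : nat) <= (2 * D).-1)%N by rewrite bdeg; lia.
  have [|c' [c'1 c'2]] := @spanned_monomial k.+1 (exist _ b bP).
    by rewrite /mdeg/= bdeg.
  exists c'; split => // x; rewrite -c'2 /monomial/= (bigD1 i)//= [RHS](bigD1 i)//=.
  rewrite bE eqxx addn1 exprS -mulrA; congr (_ * (_ * _)).
  by apply: eq_bigr => j /negPf ji; rewrite bE ji addn0.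
exists c'; split => // x; rewrite -c'2 c2 mulr_sumr; apply: eq_bigr => a _.
by rewrite mulrCA.
Qed.

Definition lform (w x : 'rV[R]_d) : R := \sum_i w 0 i * x 0 i.

Lemma spanned_mul_lform k f w : (k.+1 < 2 * D)%N ->
  spanned k f -> spanned k.+1 (fun x => lform w x * f x).
Proof.
move=> kD Sf; have [|c [c1 c2]] :=
    @spanned_sum 'I_d k.+1 (fun i x => x 0 i * f x) (fun i => w 0 i).
  by move=> i; left; exact: spanned_mul_coord.
exists c; split => // x; rewrite -c2 mulr_suml; apply: eq_bigr => i _.
by rewrite mulrA.
Qed.

(** Horner's scheme: splitting off the constant coefficient leaves a product with the linear form,
    which costs one degree. *)
Lemma spanned_horner_lform (q : {poly R}) w k : (size q <= k.+1)%N -> (k < 2 * D)%N ->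
  spanned k (fun x => q.[lform w x]).
Proof.
elim/poly_ind: q k => [|q r IHq] k.
  move=> _ _; rewrite (_ : (fun _ => _) = fun=> 0); first exact: spanned_cst.
  by apply/funext => x; rewrite horner0.
rewrite size_MXaddC; case: ifP => [/andP[/eqP-> _] _ _|_].
  rewrite (_ : (fun _ => _) = fun=> r); first exact: spanned_cst.
  by apply/funext => x; rewrite mul0r add0r hornerC.
rewrite (_ : (fun _ => _) = fun x => lform w x * q.[lform w x] + r); last first.
  by apply/funext => x; rewrite hornerMXaddC mulrC.
rewrite ltnS => qk kD; apply: spannedD; last exact: spanned_cst.
case: k qk kD => [|k] qk kD; last first.
  by apply: spanned_mul_lform => //; apply: IHq => //; exact: ltnW.
move: qk; rewrite leqn0 size_poly_eq0 => /eqP->.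
rewrite (_ : (fun _ => _) = fun=> 0); first exact: spanned_cst.
by apply/funext => x; rewrite horner0 mulr0.
Qed.

End MonomialSpan.

(** * Generic linear forms and Hermite interpolation in one variable *)

Section Hermite.
Variable R : realType.

(** The natural numbers below [size p] are too many to be all roots. *)
Lemma exists_nonroot (p : {poly R}) : p != 0 -> exists t, p.[t] != 0.
Proof.
move=> p0; apply: contrapT => H.
have := @max_poly_roots _ p [seq i%:R | i <- iota 0 (size p)] p0.
rewrite size_map size_iota ltnn => /(_ _ _)/negP[]//.
  apply/allP => t _; rewrite /root; apply/negPn/negP => pt.
  by apply: H; exists t.
by rewrite map_inj_uniq ?iota_uniq// => i j /eqP; rewrite eqr_nat => /eqP.
Qed.

(** Take coefficients [1, t, t^2, ...]: each [u j] then gives a nonzero polynomial in [t], and [t]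
    is chosen off the roots of their product. *)
Lemma exists_generic_lform d (J : finType) (u : J -> 'rV[R]_d) :
  (forall j, u j != 0) -> exists w, forall j, lform w (u j) != 0.
Proof.
move=> u0; pose p j : {poly R} := \sum_(i < d) (u j 0 i) *: 'X^i.
have p0 j : p j != 0.
  apply: contra (u0 j) => /eqP pj; apply/eqP/rowP => i; rewrite mxE.
  have /(congr1 (fun q : {poly R} => q`_i)) := pj.
  rewrite coef0 coef_sum (bigD1 i)//= coefZ coefXn eqxx mulr1 big1 ?addr0// => k ki.
  by rewrite coefZ coefXn eq_sym val_eqE (negPf ki) mulr0.
have [|t] := @exists_nonroot (\prod_j p j).
  by apply/prodf_neq0 => j _; exact: p0.
rewrite horner_prod => /prodf_neq0 pt; exists (\row_i t ^+ i) => j.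
have := pt j isT; rewrite /p horner_sum /lform; congr (_ != 0).
by apply: eq_bigr => i _; rewrite hornerZ hornerXn mxE mulrC.
Qed.

(** Take a multiple of [X - t_j] times the squares of the other factors: double roots kill value and
    derivative at the other nodes, the simple root keeps the derivative at [t_j]. *)
Lemma hermite_poly n (t : 'I_n -> R) (s : 'I_n -> R) : injective t ->
  (forall j, s j != 0) -> forall j, exists q : {poly R},
  [/\ (size q <= 2 * n)%N, forall i, q.[t i] = 0 &
      forall i, q^`().[t i] * s i = (j == i)%:R].
Proof.
move=> tinj s0 j.
pose h : {poly R} := \prod_(i < n | i != j) ('X - (t i)%:P) ^+ 2.
have h0 : h.[t j] != 0.
  rewrite /h horner_prod; apply/prodf_neq0 => i ij.
  by rewrite horner_exp hornerXsubC expf_neq0// subr_eq0 (inj_eq tinj) eq_sym.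
(* Before scaling, the derivative at [t j] is [h.[t j]]. *)
exists ((h.[t j] * s j)^-1 *: (('X - (t j)%:P) * h)); split.
- apply: (leq_trans (size_scale_leq _ _)); apply: (leq_trans (size_polyMleq _ _)).
  rewrite size_XsubC /h size_prod; last first.
    by move=> i _; rewrite expf_neq0// polyXsubC_eq0.
  rewrite (eq_bigr (fun=> 3)); last by move=> i _; rewrite size_exp_XsubC.
  have cj : #|(fun i : 'I_n => i != j)| = n.-1.
    by have := cardC1 j; rewrite card_ord.
  rewrite sum_nat_const cj.
  by have := ltn_ord j; lia.
- move=> i; rewrite hornerZ hornerM hornerXsubC; set K := _^-1.
  have [->|ij] := eqVneq i j; first by rewrite subrr mul0r mulr0.
  rewrite /h (bigD1 i)//= hornerM horner_exp hornerXsubC subrr expr0n/=.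
  by rewrite mul0r !mulr0.
- move=> i; rewrite derivZ hornerZ derivM hornerD !hornerM derivXsubC hornerC mul1r.
  rewrite hornerXsubC; have [<-|ij] := eqVneq j i.
    by rewrite subrr mul0r addr0 -mulrA mulVf// mulf_neq0.
  have hi : h = ('X - (t i)%:P) ^+ 2 * \prod_(k < n | (k != j) && (k != i)) ('X - (t k)%:P) ^+ 2.
    by rewrite /h (bigD1 i) 1?eq_sym.
  set K := _^-1; rewrite hi expr2 !derivM derivXsubC mul1r mulr1.
  rewrite !(hornerXsubC, hornerM, hornerD) subrr mulr0n.
  ring.
Qed.

End Hermite.

(** * Hermite interpolation in several variables *)

Section PolynomialTangent.
Variables (R : realType) (d D : nat).
Hypothesis D0 : (0 < D)%N.
Local Notation I := (multi_index d D).

Definition poly_diff (c : I -> R) (x v : 'rV[R]_d) : R :=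
  \sum_a c a * 'd (@monomial R d D a) x v.

Lemma monomial_tangent_lip (a : I) : tangent_lip (@monomial R d D a).
Proof.
apply: tangent_lip_prod => i; apply: tangent_lipX; exact: tangent_lip_coord.
Qed.

Lemma is_diff_poly_eval (c : I -> R) x :
  is_diff x (poly_eval c) (poly_diff c x).
Proof.
apply: is_diff_sum => a; have [dm _ _] := monomial_tangent_lip a.
exact: (@is_diffZ R _ R _ _ (c a) x (differentiableP (dm x))).
Qed.

Lemma is_diff_lform (w x : 'rV[R]_d) : is_diff x (lform w) (lform w).
Proof.
apply: is_diff_sum => i.
exact: (@is_diffZ R _ R _ _ (w 0 i) x (is_diff_coord i x)).
Qed.

Lemma is_diff_horner_lform (q : {poly R}) (w x : 'rV[R]_d) :
  is_diff x (fun y => q.[lform w y]) (fun v => q^`().[lform w x] * lform w v).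
Proof.
have dq : is_diff (lform w x) (horner q) (fun h => q^`().[lform w x] * h).
  split; first exact/derivable1_diffP/derivable_horner.
  rewrite deriv1E; last exact: derivable_horner.
  by apply/funext => h; rewrite -derivE mulrC.
exact: (@is_diff_comp R _ _ _ _ _ _ _ x (is_diff_lform w x) dq).
Qed.

(** A linear form that separates the [p j] and is nonzero on the [w j] reduces the problem to one
    variable; the pulled back polynomials have degree below [2 * n <= 2 * D]. *)
Lemma hermite_interpolation n (p w : 'I_n -> 'rV[R]_d) : (n <= D)%N ->
  injective p -> (forall j, w j != 0) ->
  exists Q : 'I_n -> I -> R, forall i j,
    poly_eval (Q i) (p j) = 0 /\ poly_diff (Q i) (p j) (w j) = (i == j)%:R.
Proof.
move=> nD pinj w0.
(* Diagonal pairs ask for nonvanishing on [w], the others for separation of [p]. *)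
have [|l lP] := @exists_generic_lform R d ('I_n * 'I_n)%type
    (fun ij => if ij.1 == ij.2 then w ij.1 else p ij.1 - p ij.2).
  move=> [i j]/=; case: (eqVneq i j) => [_|ij]; first exact: w0.
  by rewrite subr_eq0 (inj_eq pinj).
have lw j : lform l (w j) != 0 by have := lP (j, j); rewrite /= eqxx.
have lp : injective (fun j => lform l (p j)).
  move=> i j lij; apply/eqP; apply: contraT => ij.
  have := lP (i, j); rewrite /= (negPf ij) /lform.
  under eq_bigr do rewrite !mxE mulrBr.
  by rewrite sumrB -!/(lform _ _) lij subrr eqxx.
have /choice[Q QP] : forall i, exists c : I -> R, forall j,
    poly_eval c (p j) = 0 /\ poly_diff c (p j) (w j) = (i == j)%:R.
  move=> i; have [q [qn q0 q1]] := hermite_poly lp lw i.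
  have [|//|c [_ cP]] := @spanned_horner_lform R d D D0 q l (2 * D).-1.
    by rewrite prednK ?muln_gt0// (leq_trans qn)// leq_mul2l.
  - by rewrite ltn_predL muln_gt0.
  have cE : poly_eval c = fun y => q.[lform l y] by apply/funext => y; rewrite -cP.
  exists c => j; split; first by rewrite cE q0.
  have -> : poly_diff c (p j) =
      fun v => q^`().[lform l (p j)] * lform l v.
    rewrite -(@diff_val _ _ _ _ _ _ _ (is_diff_poly_eval c (p j))) cE.
    exact: (@diff_val _ _ _ _ _ _ _ (is_diff_horner_lform q l (p j))).
  exact: q1.
by exists Q => i j; exact: QP.
Qed.

End PolynomialTangent.

(** * The tangent dynamics and its dependence on the parameter *)

Section Tangent.
Variables (R : realType) (d D : nat) (phi : 'rV[R]_d -> 'rV[R]_d).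
Hypothesis Cphi : Ck 3 phi.
Local Notation I := (multi_index d D).
Implicit Type c : I -> R.

(** Tangent map of [phi_c], written so that its affine dependence on the parameter is visible. *)
Definition tangent_step c (z : 'rV[R]_d * 'rV[R]_d) : 'rV[R]_d * 'rV[R]_d :=
  (perturb phi c z.1,
   z.2 *m partials phi z.1 + poly_diff c z.1 z.2 *: e1 R d).

Lemma is_diff_perturb c x :
  is_diff x (perturb phi c) (fun v => (tangent_step c (x, v)).2).
Proof.
have dP := is_diff_poly_eval c x.
have dp : is_diff x (fun y => poly_eval c y *: e1 R d)
    (fun v => poly_diff c x v *: e1 R d).
  split; first by apply: differentiableZl; exact: ex_diff.
  by rewrite diffZl ?diff_val//; exact: ex_diff.
exact: (@is_diffD R _ _ _ _ _ _ x (Ck_is_diff x Cphi) dp).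
Qed.

Lemma iter_tangent_step_fst c j z :
  (iter j (tangent_step c) z).1 = iter j (perturb phi c) z.1.
Proof. by elim: j => [//|j IHj]; rewrite !iterS/= IHj. Qed.

Lemma is_diff_iter_perturb c j x : is_diff x (iter j (perturb phi c))
  (fun v => (iter j (tangent_step c) (x, v)).2).
Proof.
elim: j => [|j IHj]; first exact: is_diff_id.
rewrite (_ : iter j.+1 _ = perturb phi c \o iter j (perturb phi c))//.
apply: (is_diff_eq (@is_diff_comp R _ _ _ _ _ _ _ x IHj
  (is_diff_perturb c (iter j (perturb phi c) x)))); apply/funext => v /=.
by rewrite -(iter_tangent_step_fst c j (x, v)).
Qed.

Lemma is_diff_delay_map c x : is_diff x (delay_map phi c)
  (fun v => \row_(j < D) pi1 (iter j (tangent_step c) (x, v)).2).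
Proof.
(* [E j] carries the first coordinate to slot [j], so the delay map is a sum of linear images of the
   iterates. *)
pose E (j : 'I_D) : 'M[R]_(d, D) := \matrix_(i, k) ((val i == 0%N) && (k == j))%:R.
have EP (u : 'I_D -> 'rV[R]_d) : \sum_j u j *m E j = \row_j pi1 (u j).
  apply/rowP => k; rewrite summxE mxE (bigD1 k)//= big1 ?addr0; last first.
    move=> j jk; rewrite mxE big1// => i _.
    by rewrite mxE [k == j]eq_sym (negPf jk) andbF mulr0.
  rewrite mxE /pi1 [RHS]big_mkcond/=; apply: eq_bigr => i _.
  by rewrite mxE eqxx andbT; case: ifP => _; rewrite ?mulr1 ?mulr0.
rewrite (_ : delay_map phi c = fun y => \sum_(j < D) iter j (perturb phi c) y *m E j).
  apply: (@is_diff_eq R _ _ _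
    (fun v => \sum_(j < D) (iter j (tangent_step c) (x, v)).2 *m E j)).
    apply: is_diff_sum => j.
    have dE (y : 'rV[R]_d) : is_diff y (mulmxr (E j)) (mulmxr (E j)).
      apply: is_diff_linear_approx; first exact: mulmx_continuous.
      move=> eps eps0; exists 1 => // y' _.
      by rewrite linearB subrr normr0 mulr_ge0// ltW.
    exact: (@is_diff_comp R _ _ _ _ _ _ _ x (is_diff_iter_perturb c j x) (dE _)).
  by apply/funext => v; rewrite EP.
by apply/funext => y; rewrite EP.
Qed.

Local Notation N := #|{: I}|.

(** Parameters become row vectors here in order to live in a normed space. *)
Definition param (e : 'rV[R]_N) : I -> R := fun a => e 0 (enum_rank a).

Definition dot n (e f : 'rV[R]_n) : R := \sum_k e 0 k * f 0 k.

(** Coordinates of the functional sending [e] to [P_e(x)]; [dmonomials] plays the same role for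
    [dP_e(x) v]. *)
Definition monomials (z : 'rV[R]_d * 'rV[R]_d) : 'rV[R]_N :=
  \row_k monomial (enum_val k : I) z.1.

Definition dmonomials (z : 'rV[R]_d * 'rV[R]_d) : 'rV[R]_N :=
  \row_k ('d (@monomial R d D (enum_val k)) (z.1) z.2 : R).

Lemma poly_eval_dot e z : poly_eval (param e) z.1 = dot e (monomials z).
Proof.
rewrite /poly_eval (reindex_onto (@enum_val I predT) enum_rank)/=; last first.
  by move=> a _; rewrite enum_rankK.
by apply: eq_big => [k|k _]; rewrite ?enum_valK ?eqxx// /param enum_valK mxE.
Qed.

Lemma poly_diff_dot e z : poly_diff (param e) z.1 z.2 = dot e (dmonomials z).
Proof.
rewrite /poly_diff (reindex_onto (@enum_val I predT) enum_rank)/=; last first.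
  by move=> a _; rewrite enum_rankK.
by apply: eq_big => [k|k _]; rewrite ?enum_valK ?eqxx// /param enum_valK mxE.
Qed.

Lemma loclip_row (V : normedModType R) n (g : 'I_n -> V -> R) x :
  (forall k, loclip (g k) x) -> loclip (fun y => \row_k g k y) x.
Proof.
move=> H; rewrite (_ : (fun _ => _) =
    fun y => \sum_k g k y *: (delta_mx 0 k : 'rV[R]_n)); last first.
  apply/funext => y; apply/rowP => k; rewrite summxE mxE (bigD1 k)//=.
  rewrite !mxE !eqxx mulr1 big1 ?addr0// => i ik.
  by rewrite !mxE [k == i]eq_sym (negPf ik) andbF mulr0.
by apply: loclip_sum => k; apply: loclipZ => //; exact: loclip_cst.
Qed.

Lemma loclip_monomials z : loclip monomials z.
Proof.
apply: loclip_row => k; have [_ lm _] := monomial_tangent_lip R (enum_val k : I).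
exact: (@loclip_comp _ _ _ _ fst (monomial (enum_val k))
  z (loclip_fst z) (lm _)).
Qed.

Lemma loclip_dmonomials z : loclip dmonomials z.
Proof.
by apply: loclip_row => k; have [_ _] := monomial_tangent_lip R (enum_val k : I).
Qed.

Lemma loclip_dot (V : normedModType R) n (f g : V -> 'rV[R]_n) x :
  loclip f x -> loclip g x -> loclip (fun y => dot (f y) (g y)) x.
Proof.
move=> lf lg; apply: loclip_sum => k; apply: loclipM.
  exact: (loclip_comp lf (loclip_coord k _)).
exact: (loclip_comp lg (loclip_coord k _)).
Qed.

Local Notation state := ('rV[R]_N * ('rV[R]_d * 'rV[R]_d))%type.

Definition orb j (y : state) := iter j (tangent_step (param y.1)) y.2.

Lemma loclip_orb j (y : state) : loclip (orb j) y.
Proof.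
elim: j => [|j IHj]; first exact: loclip_snd.
have lfst : loclip (fun y : state => (orb j y).1) y.
  exact: (loclip_comp IHj (loclip_fst _)).
rewrite (_ : orb j.+1 = fun y : state =>
    (phi (orb j y).1 + dot y.1 (monomials (orb j y)) *: e1 R d,
     (orb j y).2 *m partials phi (orb j y).1 +
       dot y.1 (dmonomials (orb j y)) *: e1 R d)); last first.
  apply/funext => y'; rewrite /orb iterS /tangent_step.
  by rewrite -poly_eval_dot -poly_diff_dot.
apply: loclip_pair; apply: loclipD.
- exact: (loclip_comp lfst (Ck_loclip _ Cphi)).
- apply: loclipZ; last exact: loclip_cst.
  by apply: loclip_dot; [exact: loclip_fst|exact: (loclip_comp IHj (loclip_monomials _))].
- exact: (@loclip_comp _ _ _ _ (orb j) (fun z => z.2 *m partials phi z.1) y IHj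
    (Ck_loclip_tangent _ Cphi)).
- apply: loclipZ; last exact: loclip_cst.
  by apply: loclip_dot; [exact: loclip_fst|exact: (loclip_comp IHj (loclip_dmonomials _))].
Qed.

End Tangent.

(** * Estimates of type O(rho) + o(del) on pairs of points *)

Section Control.
Variables (R : realType) (V : normedModType R) (Z : set V) (z0 : V).
Variables rho del : V -> V -> R.
Hypotheses (rho0 : forall z z', 0 <= rho z z') (del0 : forall z z', 0 <= del z z').

Definition nearby (r : R) z := Z z /\ `|z - z0| < r.

(* [g = O(rho) + o(del)] on pairs of points of [Z] near [z0] *)
Definition controlled (g : V -> V -> R) :=
  exists2 C : R, 0 < C & forall eta : R, 0 < eta -> exists2 r : R, 0 < r &
    forall z z', nearby r z -> nearby r z' -> g z z' <= C * rho z z' + eta * del z z'.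

Lemma nearby_le r s z : r <= s -> nearby r z -> nearby s z.
Proof. by move=> rs [Zz zr]; split=> //; exact: lt_le_trans rs. Qed.

Lemma controlled_trans (C : R) (r : R) g h : 0 < r -> controlled h ->
  (forall z z', nearby r z -> nearby r z' -> g z z' <= C * h z z') ->
  (forall z z', 0 <= h z z') -> controlled g.
Proof.
move=> r0 [K K0 KP] gh h0; pose C' := `|C| + 1.
have C'0 : 0 < C' by rewrite ltr_wpDl.
exists (C' * K) => [|eta eta0]; first exact: mulr_gt0.
have [|s s0 sP] := KP (eta / C'); first exact: divr_gt0.
exists (Num.min r s) => [|z z' Nz Nz']; first by rewrite lt_min r0.
have mr : Num.min r s <= r by rewrite ge_min lexx.
have ms : Num.min r s <= s by rewrite ge_min lexx orbT.
apply: (le_trans (gh z z' (nearby_le mr Nz) (nearby_le mr Nz'))).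
apply: (@le_trans _ _ (C' * h z z')).
  by rewrite ler_wpM2r// (le_trans (ler_norm C))// lerDl.
have := sP z z' (nearby_le ms Nz) (nearby_le ms Nz').
rewrite -(ler_pM2l C'0) => /le_trans; apply.
by rewrite mulrDr !mulrA [C' * eta]mulrC mulfK ?gt_eqF.
Qed.

Lemma controlledD g h : controlled g -> controlled h ->
  controlled (fun z z' => g z z' + h z z').
Proof.
move=> [C C0 CP] [K K0 KP]; exists (C + K) => [|eta eta0]; first exact: addr_gt0.
have [|r r0 rP] := CP (eta / 2); first exact: divr_gt0.
have [|s s0 sP] := KP (eta / 2); first exact: divr_gt0.
exists (Num.min r s) => [|z z' Nz Nz']; first by rewrite lt_min r0.
have mr : Num.min r s <= r by rewrite ge_min lexx.
have ms : Num.min r s <= s by rewrite ge_min lexx orbT.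
have := rP z z' (nearby_le mr Nz) (nearby_le mr Nz').
have := sP z z' (nearby_le ms Nz) (nearby_le ms Nz').
set a := rho z z'; set b := del z z'; lra.
Qed.

Lemma controlled_rho : controlled rho.
Proof.
exists 1 => // eta eta0; exists 1 => // z z' _ _.
by rewrite mul1r lerDl mulr_ge0// ltW.
Qed.

Lemma controlled_o g :
  (forall eta : R, 0 < eta -> exists2 r : R, 0 < r &
    forall z z', nearby r z -> nearby r z' -> g z z' <= eta * del z z') ->
  controlled g.
Proof.
move=> H; exists 1 => // eta eta0; have [r r0 rP] := H _ eta0.
exists r => // z z' Nz Nz'; apply: (le_trans (rP z z' Nz Nz')).
by rewrite lerDr mul1r.
Qed.

Lemma controlled_le g h : controlled h ->
  (forall z z', Z z -> Z z' -> g z z' <= h z z') -> controlled g.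
Proof.
move=> [C C0 CP] gh; exists C => // eta eta0; have [r r0 rP] := CP _ eta0.
exists r => // z z' Nz Nz'; apply: le_trans (rP z z' Nz Nz').
by apply: gh; [case: Nz|case: Nz'].
Qed.

Lemma controlled_sum (J : finType) (g : J -> V -> V -> R) :
  (forall j, controlled (g j)) -> controlled (fun z z' => \sum_j g j z z').
Proof.
move=> H; suff : forall s : seq J, controlled (fun z z' => \sum_(j <- s) g j z z').
  by exact.
elim=> [|j s IHs].
  apply: (controlled_le controlled_rho) => z z' _ _.
  by rewrite big_nil.
apply: (controlled_le (controlledD (H j) IHs)) => z z' _ _.
by rewrite big_cons.
Qed.

Lemma controlled_loclip (U W : normedModType R) (f : V -> U) (h : U -> W) :
  loclip f z0 -> loclip h (f z0) ->
  controlled (fun z z' => `|f z - f z'|) ->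
  controlled (fun z z' => `|h (f z) - h (f z')|).
Proof.
move=> lf [C [s [C0 s0 H]]] cf; have [r r0 rP] := loclip_near lf s0.
apply: (@controlled_trans C r _ _ r0 cf) => // z z' [_ zr] [_ zr'].
by apply: H; exact: rP.
Qed.

End Control.

Section Dot.
Variables (R : realType) (n : nat).
Implicit Types e f : 'rV[R]_n.

Lemma dotBl e e' f : dot (e - e') f = dot e f - dot e' f.
Proof.
by rewrite /dot -sumrB; apply: eq_bigr => k _; rewrite !mxE mulrBl.
Qed.

Lemma dotBr e f f' : dot e (f - f') = dot e f - dot e f'.
Proof.
by rewrite /dot -sumrB; apply: eq_bigr => k _; rewrite !mxE mulrBr.
Qed.

Lemma dot_norm_le e f : `|dot e f| <= n%:R * `|e| * `|f|.
Proof.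
rewrite (le_trans (ler_norm_sum _ _ _))// -mulrA mulr_natl.
rewrite -[X in _ *+ X]card_ord -sumr_const; apply: ler_sum => k _.
by rewrite normrM ler_pM ?coord_le_norm.
Qed.

End Dot.

(** With [e, e'] the parameters of [z, z'] and [u = h \o f], the expression is the sum of the
    pairings of [e - e'] with [u z - u z0] and of [e'] with [u z - u z']. The first is o(del) since
    [u z] is close to [u z0]; the second is controlled since [e'] stays bounded. *)
Lemma controlled_dot (R : realType) (n : nat) (U W : normedModType R)
    (Z : set ('rV[R]_n * U)) z0 (rho : _ -> _ -> R) (f : 'rV[R]_n * U -> W)
    (h : W -> 'rV[R]_n) (del := fun z z' : 'rV[R]_n * U => `|z.1 - z'.1|) :
  (forall z z', 0 <= rho z z') ->
  loclip f z0 -> loclip h (f z0) ->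
  controlled Z z0 rho del (fun z z' => `|f z - f z'|) ->
  controlled Z z0 rho del (fun z z' =>
    `|dot z.1 (h (f z)) - dot z'.1 (h (f z')) - dot (z.1 - z'.1) (h (f z0))|).
Proof.
move=> rho0 lf lh cf.
have del0 z z' : 0 <= del z z' by exact: normr_ge0.
have lhf := loclip_comp lf lh.
have c1 : controlled Z z0 rho del
    (fun z z' => `|dot (z.1 - z'.1) (h (f z) - h (f z0))|).
  apply: controlled_o => // eta eta0.
  have [|r r0 rP] := loclip_near (e := eta / n.+1%:R) lhf; first exact: divr_gt0.
  exists r => // z z' [_ zr] _; apply: (le_trans (dot_norm_le _ _)).
  rewrite -mulrA mulrCA -/(del z z') mulrC ler_wpM2r//.
  apply: (@le_trans _ _ (n.+1%:R * (eta / n.+1%:R))); last by rewrite mulrC divfK.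
  by apply: ler_pM => //; [rewrite ler_nat|exact/ltW/rP].
have c2 : controlled Z z0 rho del
    (fun z z' => `|dot z'.1 (h (f z) - h (f z'))|).
  apply: (@controlled_trans _ _ _ _ _ _ (n%:R * (`|z0.1| + 1)) 1 _ _
      ltr01 (controlled_loclip lf lh cf)) => // z z' _ [_ zr'].
  apply: (le_trans (dot_norm_le _ _)); rewrite ler_wpM2r// ler_wpM2l//.
  rewrite -[z'.1](subrK z0.1) addrC (le_trans (ler_normD _ _))// lerD2l.
  by apply: (le_trans (normr_fst_le (z' - z0))); exact: ltW.
apply: (controlled_le (controlledD c1 c2)) => z z' _ _.
rewrite (le_trans _ (ler_normD _ _))// le_eqVlt; apply/orP; left; apply/eqP.
by congr `|_|; rewrite !dotBl !dotBr; ring.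
Qed.

(** Reads a matrix of rank at most [r] through [r] linear coordinates; the [pid_mx] blocks pad the
    factorization to that width. *)
Lemma rank_factorization (F : fieldType) (n r : nat) (M : 'M[F]_n) :
  (\rank M <= r)%N -> exists (A : 'M[F]_(n, r)) (B : 'M[F]_(r, n)), M = A *m B.
Proof.
move=> Mr; exists (col_base M *m pid_mx (\rank M)), (pid_mx (\rank M) *m row_base M).
have pid1 : (pid_mx (\rank M) : 'M[F]_(\rank M, r)) *m
    (pid_mx (\rank M) : 'M[F]_(r, \rank M)) = 1%:M.
  by rewrite mul_pid_mx minnn (minn_idPr Mr) pid_mx_1.
by rewrite mulmxA -[col_base M *m _ *m _]mulmxA pid1 mulmx1 mulmx_base.
Qed.

Lemma pi1_e1 (R : realType) d : (0 < d)%N -> pi1 (e1 R d) = 1.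
Proof.
move=> d0; rewrite /pi1 (big_pred1 (Ordinal d0)) ?mxE//.
Qed.

Lemma pi1DZ (R : realType) d (u v : 'rV[R]_d) s :
  pi1 (u + s *: v) = pi1 u + s * pi1 v.
Proof.
by rewrite /pi1 mulr_sumr -big_split; apply: eq_bigr => i _; rewrite !mxE.
Qed.

Lemma loclip_pi1 (R : realType) d (x : 'rV[R]_d) : loclip (@pi1 R d) x.
Proof.
rewrite (_ : @pi1 R d = fun u => \sum_i (val i == 0%N)%:R * u 0 i).
  apply: loclip_sum => i; apply: loclipM; first exact: loclip_cst.
  exact: loclip_coord.
apply/funext => u; rewrite /pi1 big_mkcond; apply: eq_bigr => i _.
by case: ifP => _; rewrite ?mul1r ?mul0r.
Qed.

(** * Local Lipschitz dependence of the parameter on fewer coordinates *)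

Section LocalEstimate.
Variables (R : realType) (d D : nat) (phi : 'rV[R]_d -> 'rV[R]_d).
Hypotheses (d0 : (0 < d)%N) (D0 : (0 < D)%N) (Cphi : Ck 3 phi).
Local Notation I := (multi_index d D).
Local Notation N := #|{: I}|.
Local Notation state := ('rV[R]_N * ('rV[R]_d * 'rV[R]_d))%type.
Local Notation orb := (@orb R d D phi).
Variables (Z : set state) (z0 : state).
Hypothesis Zpi1 : forall z j, Z z -> (j < D)%N -> pi1 (orb j z).2 = 0.
Local Notation n := (D.-1).

(** Column [j] is the functional [P_e(x_j)], and [dP_e(x_j) v_j] in [diffmx], both frozen along the
    orbit of [z0]. *)
Definition evalmx : 'M[R]_(N, n) := \matrix_(k < N, j < n) monomials D (orb j z0) 0 k.
Definition diffmx : 'M[R]_(N, n) := \matrix_(k < N, j < n) dmonomials D (orb j z0) 0 k.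

Lemma mul_evalmx (e : 'rV[R]_N) j : (e *m evalmx) 0 j = dot e (monomials D (orb j z0)).
Proof. by rewrite mxE; apply: eq_bigr => k _; rewrite mxE. Qed.

Lemma mul_diffmx (e : 'rV[R]_N) j : (e *m diffmx) 0 j = dot e (dmonomials D (orb j z0)).
Proof. by rewrite mxE; apply: eq_bigr => k _; rewrite mxE. Qed.

Let rho (z z' : state) : R := `|z.2 - z'.2| + `|(z.1 - z'.1) *m evalmx|.
Let del (z z' : state) : R := `|z.1 - z'.1|.
Local Notation ctrl := (controlled Z z0 rho del).

Let rho0 z z' : 0 <= rho z z'. Proof. by rewrite addr_ge0. Qed.
Let del0 z z' : 0 <= del z z'. Proof. exact: normr_ge0. Qed.

Definition drop1 : 'M[R]_d := \matrix_(i, j) ((i == j) && (val i != 0%N))%:R.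

Lemma mul_drop1 (u : 'rV[R]_d) : u *m drop1 = u - pi1 u *: e1 R d.
Proof.
apply/rowP => j; rewrite !mxE (bigD1 j)//= mxE eqxx big1 ?addr0; last first.
  by move=> i ij; rewrite mxE (negPf ij) mulr0.
have [j0|j0] := eqVneq (val j) 0%N; last by rewrite mulr1 mulr0 subr0.
rewrite mulr0 mulr1 /pi1 (big_pred1 j) ?subrr// => i.
by rewrite /= -j0 val_eqE.
Qed.

Lemma orb_sndS z j : (orb j.+1 z).2 = (orb j z).2 *m partials phi (orb j z).1 +
  dot z.1 (dmonomials D (orb j z)) *: e1 R d.
Proof. by rewrite -poly_diff_dot. Qed.

(** The perturbation only moves the first coordinate, which vanishes on [Z]; projecting it away
    removes the parameter. *)
Lemma orb_snd_drop1 z j : Z z -> (j.+1 < D)%N -> (orb j.+1 z).2 =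
  (orb j z).2 *m partials phi (orb j z).1 *m drop1.
Proof.
move=> Zz jD; rewrite -[LHS]subr0 -(scale0r (e1 R d)) -(Zpi1 Zz jD) -mul_drop1.
rewrite orb_sndS mulmxDl -scalemxAl [e1 _ _ *m _]mul_drop1 pi1_e1//.
by rewrite scale1r subrr scaler0 addr0.
Qed.

(** The vanishing first coordinate, solved for the perturbation term: on [Z] this term depends on
    [(x_j, v_j)] alone. *)
Lemma dot_dmonomials_orb z j : Z z -> (j.+1 < D)%N ->
  dot z.1 (dmonomials D (orb j z)) =
  - pi1 ((orb j z).2 *m partials phi (orb j z).1).
Proof.
move=> Zz jD; have := Zpi1 Zz jD.
rewrite orb_sndS pi1DZ pi1_e1// mulr1 => /eqP.
by rewrite addrC addr_eq0 => /eqP.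
Qed.

Lemma ctrl_orb j : (j < D)%N -> ctrl (fun z z' => `|orb j z - orb j z'|).
Proof.
elim: j => [_|j IHj jD].
  by apply: (controlled_le (controlled_rho Z z0 rho del0)) => z z' _ _; rewrite lerDl.
have {}IHj := IHj (ltnW jD).
have lo := loclip_orb Cphi j z0.
have cphi : ctrl (fun z z' => `|phi (orb j z).1 - phi (orb j z').1|).
  apply: (@controlled_loclip _ _ _ _ _ _ _ _ (orb j) (fun u => phi u.1)) => //.
  exact: (loclip_comp (loclip_fst _) (Ck_loclip _ Cphi)).
have ctan : ctrl (fun z z' => `|(orb j z).2 *m partials phi (orb j z).1 *m drop1 -
    (orb j z').2 *m partials phi (orb j z').1 *m drop1|).
  apply: (@controlled_loclip _ _ _ _ _ _ _ _ (orb j)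
    (fun u => u.2 *m partials phi u.1 *m drop1)) => //.
  exact: (@loclip_comp _ _ _ _ (fun u => u.2 *m partials phi u.1)
    (fun u => u *m drop1) _ (Ck_loclip_tangent _ Cphi) (loclip_mulmx _ _)).
have cdot := controlled_dot rho0 lo (loclip_monomials D _) IHj.
have jn : (j < n)%N by lia.
have cs := controlledD (controlledD cphi ctan)
  (controlledD cdot (controlled_rho Z z0 rho del0)).
apply: (controlled_le cs) => z z' Zz Zz' /=.
rewrite prod_normE ge_max; apply/andP; split; last first.
  rewrite -[X in `|X|]/((orb j.+1 z).2 - (orb j.+1 z').2) !orb_snd_drop1// -addrA addrCA lerDl.
  by rewrite !addr_ge0.
rewrite -[X in `|X|]/((orb j.+1 z).1 - (orb j.+1 z').1).
have orb1 y : (orb j.+1 y).1 =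
    phi (orb j y).1 + dot y.1 (monomials D (orb j y)) *: e1 R d.
  by rewrite -poly_eval_dot.
rewrite !orb1 [X in `|X|](_ : _ = (phi (orb j z).1 - phi (orb j z').1) +
  (dot z.1 (monomials D (orb j z)) - dot z'.1 (monomials D (orb j z'))) *: e1 R d); last first.
  by rewrite scalerBl opprD addrACA.
rewrite (le_trans (ler_normD _ _))// -addrA lerD2l ler_wpDl//.
have e1le : `|e1 R d| <= 1.
  apply: norm_le_coord => // i; rewrite mxE.
  by case: eqP => _; rewrite ?normr1 ?normr0.
rewrite normrZ (le_trans (ler_piMr _ e1le))//.
set a := dot _ _ - _; set b := dot (z.1 - z'.1) _.
have := ler_normD (a - b) b; rewrite subrK => /le_trans; apply; rewrite lerD2l.
rewrite ler_wpDl//; have -> : b = ((z.1 - z'.1) *m evalmx) 0 (Ordinal jn).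
  by rewrite mul_evalmx.
exact: coord_le_norm.
Qed.

Lemma ctrl_diffmx : ctrl (fun z z' => `|(z.1 - z'.1) *m diffmx|).
Proof.
suff cj (j : 'I_n) : ctrl (fun z z' => `|((z.1 - z'.1) *m diffmx) 0 j|).
  apply: (controlled_le (controlled_sum rho0 del0 cj)) => z z' _ _ /=.
  apply: norm_le_coord => [|j]; first exact: sumr_ge0.
  by rewrite (bigD1 j)//= lerDl sumr_ge0.
have jD : (j.+1 < D)%N by have := ltn_ord j; lia.
have co := ctrl_orb (ltnW jD).
have lo := loclip_orb Cphi j z0.
pose g (u : 'rV[R]_d * 'rV[R]_d) := pi1 (u.2 *m partials phi u.1).
have cpi : ctrl (fun z z' => `|g (orb j z) - g (orb j z')|).
  apply: controlled_loclip => //.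
  exact: (@loclip_comp _ _ _ _ (fun u => u.2 *m partials phi u.1) (@pi1 R d) _
    (Ck_loclip_tangent _ Cphi) (loclip_pi1 _)).
have cdot := controlled_dot rho0 lo (loclip_dmonomials D _) co.
apply: (controlled_le (controlledD cpi cdot)) => z z' Zz Zz' /=.
rewrite mul_diffmx.
have -> : dot z.1 (dmonomials D (orb j z)) = - g (orb j z).
  exact: dot_dmonomials_orb Zz jD.
have -> : dot z'.1 (dmonomials D (orb j z')) = - g (orb j z').
  exact: dot_dmonomials_orb Zz' jD.
have aux (p q a : R) : `|a| <= `|p - q| + `|- p - - q - a|.
  have := ler_normD (p - q) (- p - - q - a).
  by rewrite (_ : p - q + (- p - - q - a) = - a) ?normrN//; ring.
exact: aux.
Qed.

Hypothesis distinct : forall i j : 'I_n, (orb i z0).1 = (orb j z0).1 -> i = j.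
Hypothesis nonzero : forall j : 'I_n, (orb j z0).2 != 0.

(** Split the increment as [e = e *m Pi + e *m diffmx *m Qm], where the rows of [Qm] are the dual
    interpolating polynomials. The first part is read through [N - n] coordinates [A] and determines
    [e *m evalmx]; the second is bounded by [ctrl_diffmx]. *)
Lemma local_lipschitz_graph : exists (A : 'M[R]_(N, N - n)) (C r : R), [/\ (n <= N)%N, 0 < r &
  forall z z', nearby Z z0 r z -> nearby Z z0 r z' ->
    `|z.1 - z'.1| <= C * (`|(z.1 - z'.1) *m A| + `|z.2 - z'.2|)].
Proof.
have [|//|//|Q QP] := @hermite_interpolation R d D D0 n
    (fun j => (orb j z0).1) (fun j => (orb j z0).2).
  by rewrite leq_pred.
pose q i : 'rV[R]_N := \row_k Q i (enum_val k).
have paramq i : param (q i) = Q i.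
  by apply/funext => a; rewrite /param mxE enum_rankK.
pose Qm : 'M[R]_(n, N) := \matrix_(i, k) q i 0 k.
have rowQ i : row i Qm = q i by apply/rowP => k; rewrite !mxE.
have QU : Qm *m diffmx = 1%:M.
  apply/matrixP => i j; have := mul_diffmx (q i) j.
  rewrite -rowQ -row_mul mxE => ->; rewrite rowQ -poly_diff_dot paramq.
  by have [_ ->] := QP i j; rewrite mxE.
have QW : Qm *m evalmx = 0.
  apply/matrixP => i j; have := mul_evalmx (q i) j.
  rewrite -rowQ -row_mul mxE => ->; rewrite rowQ -poly_eval_dot paramq.
  by have [-> _] := QP i j; rewrite mxE.
pose Pi : 'M[R]_N := 1%:M - diffmx *m Qm.
have PiW : Pi *m evalmx = evalmx.
  by rewrite mulmxBl mul1mx -mulmxA QW mulmx0 subr0.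
have QPi : Qm *m Pi = 0 by rewrite mulmxBr mulmx1 mulmxA QU mul1mx subrr.
have rankQ : \rank Qm = n.
  by apply/eqP; rewrite -/(row_free Qm); apply/row_freeP; exists diffmx.
have rankPi : (\rank Pi <= N - n)%N.
  by have := mulmx0_rank_max QPi; rewrite rankQ; lia.
have [A [B PiAB]] := rank_factorization rankPi.
have [K1 K10 K1P] := mulmx_norm_le B.
have [K2 K20 K2P] := mulmx_norm_le Qm.
have [K3 K30 K3P] := mulmx_norm_le (B *m evalmx).
have [C C0 CP] := ctrl_diffmx.
(* With this [eta] the o(del) term, multiplied by [K2], is half of the norm of [e]. Absorbing it on
   the left gives the factor 2 in the constant below. *)
have [|r r0 rP] := CP (2 * K2)^-1; first by rewrite invr_gt0 mulr_gt0.
exists A, (2 * (K1 + K2 * C * (1 + K3))), r; split => //.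
  by rewrite -rankQ rank_leq_col.
move=> z z' Nz Nz'.
have := rP z z' Nz Nz'; rewrite /rho /del.
set e := z.1 - z'.1; set y := `|z.2 - z'.2|; set a := `|e *m A| => H.
have eW : `|e *m evalmx| <= K3 * a.
  by rewrite -PiW PiAB -[A *m _ *m _]mulmxA [e *m _]mulmxA; exact: K3P.
have eE : `|e| <= K1 * a + K2 * `|e *m diffmx|.
  have -> : `|e| = `|e *m A *m B + e *m diffmx *m Qm|.
    by rewrite -!mulmxA -PiAB -mulmxDr /Pi subrK mulmx1.
  by rewrite (le_trans (ler_normD _ _))// lerD.
have a0 : 0 <= a by exact: normr_ge0.
have y0 : 0 <= y by exact: normr_ge0.
have : K2 * `|e *m diffmx| <= K2 * C * (y + K3 * a) + `|e| / 2.
  rewrite (le_trans (ler_wpM2l (ltW K20) H))// mulrDr mulrA lerD//.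
    by rewrite ler_wpM2l ?mulr_ge0 ?(ltW K20) ?(ltW C0)// lerD2l.
  by rewrite mulrA invfM [K2 * (_ / _)]mulrCA divff ?gt_eqF// mulr1 mulrC.
have K2C : 0 <= K2 * C by rewrite mulr_ge0// ltW.
have := mulr_ge0 (mulr_ge0 K2C (ltW K30)) y0; have := mulr_ge0 K2C a0.
have := mulr_ge0 (ltW K10) y0.
move: eE; set E := `|e|; set F := K2 * `|_|; lra.
Qed.

End LocalEstimate.

(** The chain rule applied to [g \o phi_c = id], with [g] the inverse, makes the differential
    injective. *)
Lemma tangent_step_neq0 (R : realType) (d D : nat) (phi : 'rV[R]_d -> 'rV[R]_d)
    (c : multi_index d D -> R) (z : 'rV[R]_d * 'rV[R]_d) :
  Ck 3 phi -> Ck_diffeo 3 (perturb phi c) -> z.2 != 0 ->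
  (tangent_step phi c z).2 != 0.
Proof.
case: z => x v /= Cphi [g [fg [_ [_ Cg]]]] v0; apply: contra v0 => /eqP Ev.
have := @is_diff_comp R _ _ _ _ _ _ _ x (is_diff_perturb Cphi c x)
  (Ck_is_diff (perturb phi c x) Cg).
have -> : g \o perturb phi c = id by apply/funext => y /=; rewrite fg.
move=> /@diff_val; rewrite (@diff_val _ _ _ _ _ _ _ (is_diff_id x)).
by move=> /(congr1 (fun h => h v)) /= ->; rewrite Ev mul0mx.
Qed.

Lemma iter_periodic_of_eq (T : Type) (f : T -> T) (i j : nat) (x : T) :
  injective f -> (i <= j)%N -> iter i f x = iter j f x -> iter (j - i) f x = x.
Proof.
move=> finj /subnK ij; rewrite -{1}ij addnC iterD; move: (iter (j - i) f x) => y.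
by elim: i {ij} => [//|i IHi] /= /finj.
Qed.

Lemma row_mxB (V : zmodType) m n (a a' : 'rV[V]_m) (b b' : 'rV[V]_n) k :
  row_mx a b 0 k - row_mx a' b' 0 k = row_mx (a - a') (b - b') 0 k.
Proof. by rewrite -add_row_mx -opp_row_mx [RHS]mxE [X in _ = _ + X]mxE. Qed.

Lemma norm_row_mx_le (R : realType) m n (a : 'rV[R]_m) (b : 'rV[R]_n) (t : R) :
  0 <= t -> (forall k, `|row_mx a b 0 k| <= t) -> `|a| <= t /\ `|b| <= t.
Proof.
move=> t0 H; split; apply: norm_le_coord => // i.
  by have := H (lshift n i); rewrite row_mxEl.
by have := H (rshift m i); rewrite row_mxEr.
Qed.

Lemma row_mx_norm_le (R : realType) m n (a : 'rV[R]_m) (b : 'rV[R]_n) :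
  `|row_mx a b| <= `|a| + `|b|.
Proof.
apply: norm_le_coord => [|k]; first exact: addr_ge0.
case: (splitP k) => [i ki|i ki].
  rewrite (_ : k = lshift n i) ?row_mxEl; last exact: val_inj.
  by rewrite (le_trans (coord_le_norm _ _))// lerDl.
rewrite (_ : k = rshift m i) ?row_mxEr; last exact: val_inj.
by rewrite (le_trans (coord_le_norm _ _))// lerDr.
Qed.

(** * Covering the bad parameters *)

Unset Implicit Arguments.

Theorem theorem21 (R : realType) (d D : nat)
  (hd : (0 < d)%N) (hD : (4 * d <= D)%N)
  (phi : 'rV[R]_d -> 'rV[R]_d)
  (rK rKp a0 : R) (hrK : 0 <= rK) (hKKp : rK <= rKp) (ha0 : 0 < a0)
  (* K = closed Euclidean ball of radius rK, K^+ = closed ball of radius rKp *)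
  (hKp : forall x : 'rV[R]_d, enorm x <= rK ->
     forall j : nat, (j < D)%N -> enorm (iter j phi x) <= rKp)
  (ha0K : forall c : multi_index d D -> R, enormI c <= a0 ->
     forall x : 'rV[R]_d, enorm x <= rK ->
     forall j : nat, (j < D)%N -> enorm (iter j (perturb phi c) x) <= rKp)
  (m : nat) (xi : 'I_m -> (multi_index d D -> R) -> 'rV[R]_d)
  (* (1) phi_c is a C^3 diffeomorphism *)
  (H1 : forall c : multi_index d D -> R, enormI c <= a0 ->
     Ck_diffeo 3 (perturb phi c))
  (* (2) the fixed points of phi_c are exactly xi_1(c), ..., xi_m(c) *)
  (H2 : forall c : multi_index d D -> R, enormI c <= a0 ->
     (forall i : 'I_m, perturb phi c (xi i c) = xi i c) /\
     (forall x : 'rV[R]_d, perturb phi c x = x -> exists i : 'I_m, x = xi i c))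
  (* (3) no other periodic points of period less than 2D *)
  (H3 : forall c : multi_index d D -> R, enormI c <= a0 ->
     forall (p : nat) (x : 'rV[R]_d), (0 < p < 2 * D)%N ->
     iter p (perturb phi c) x = x -> perturb phi c x = x)
  (* (4) hyperbolicity and distinct first coordinates *)
  (H4 : forall c : multi_index d D -> R, enormI c <= a0 ->
     forall i : 'I_m, hyperbolic_at (perturb phi c) (xi i c))
  (H4' : forall c : multi_index d D -> R, enormI c <= a0 ->
     forall i j : 'I_m, i != j -> pi1 (xi i c) != pi1 (xi j c))
  (* (5) F_c immersive at each fixed point *)
  (H5 : forall c : multi_index d D -> R, enormI c <= a0 ->
     forall i : 'I_m, immersive_at (delay_map phi c) (xi i c)) :
  lebesgue_null
    [set c : multi_index d D -> R | enormI c < a0 /\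
       ~ (forall x : 'rV[R]_d, enorm x <= rK -> immersive_at (delay_map phi c) x)].
Proof.
have D0 : (0 < D)%N by lia.
have Cphi : Ck 3 phi.
  (* Smoothness of [phi] itself is the case of the zero parameter. *)
  have [|g [_ [_ [+ _]]]] := H1 (fun=> 0).
    rewrite /enormI big1 ?sqrtr0 ?ltW// => i _.
    by rewrite expr0n.
  rewrite (_ : perturb phi (fun=> 0) = phi)//; apply/funext => x.
  by rewrite /perturb big1 ?scale0r ?addr0// => a _; rewrite mul0r.
pose N := #|{: multi_index d D}|.
pose Z := [set z : 'rV[R]_N * ('rV[R]_d * 'rV[R]_d) |
  [/\ enormI (param z.1) < a0, z.2.2 != 0,
      perturb phi (param z.1) z.2.1 <> z.2.1 &
      forall j, (j < D)%N -> pi1 (orb phi j z).2 = 0]].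
apply: (@lebesgue_null_sub _ _ _ ((fun z => param z.1) @` Z)).
  move=> c [ca0 nimm].
  have : exists x v : 'rV[R]_d, [/\ v != 0, 'd (delay_map phi c) x v = 0 &
      perturb phi c x <> x].
    apply: contrapT => H; apply: nimm => x _; split.
      by have [] := is_diff_delay_map Cphi c x.
    (* A kernel vector at a fixed point would contradict [H5], so bad parameters come from points
       that are not fixed. *)
    move=> v v0; apply/eqP => dv; apply: H; exists x, v; split => // fx.
    have [_ /(_ x fx)[i xE]] := H2 c (ltW ca0).
    have [_ /(_ v v0)] := H5 c (ltW ca0) i.
    by rewrite -xE dv eqxx.
  move=> [x [v [v0 dv fx]]].
  pose e : 'rV[R]_N := \row_k c (enum_val k).
  have eE : param e = c by apply/funext => a; rewrite /param mxE enum_rankK.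
  exists (e, (x, v)) => //=; split; rewrite /= ?eE// => j jD.
  move: dv; rewrite (@diff_val _ _ _ _ _ _ _ (is_diff_delay_map Cphi c x)).
  by move=> /rowP/(_ (Ordinal jD)); rewrite !mxE /orb /= eE.
have Zpi1 z j : Z z -> (j < D)%N -> pi1 (orb phi j z).2 = 0.
  by move=> [_ _ _ +]; apply.
have loc z0 : Z z0 -> exists (A : 'M[R]_(N, N - D.-1)) (C r : R),
  [/\ (D.-1 <= N)%N, 0 < r & forall z z', nearby Z z0 r z -> nearby Z z0 r z' ->
    `|z.1 - z'.1| <= C * (`|(z.1 - z'.1) *m A| + `|z.2 - z'.2|)].
  move=> Zz0; have [ca0 v0 fx _] := Zz0.
  have [g [fg [gf [Cf Cg]]]] := H1 _ (ltW ca0).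
  have finj : injective (perturb phi (param z0.1)) by exact: can_inj fg.
  apply: (@local_lipschitz_graph R d D phi hd D0 Cphi Z z0 Zpi1) => [i j|j].
    rewrite !iter_tangent_step_fst => eij.
    wlog ij : i j eij / (i <= j)%N.
      by move=> W; have [/W->//|/ltnW/W->] := leqP i j.
    (* Two equal orbit points would give a period [j - i < 2 * D], hence a fixed point by [H3],
       which [Z] excludes. *)
    apply/val_inj/eqP; rewrite eqn_leq ij /= leqNgt; apply/negP => lij.
    apply: fx; apply: (H3 _ (ltW ca0) (j - i)%N); last first.
      exact: iter_periodic_of_eq eij.
    by have := ltn_ord j; lia.
  rewrite /orb; elim: (val j) => [//|k IHk]; rewrite iterS.
  by apply: tangent_step_neq0 => //; exact: H1 (ltW ca0).
have [i0 _] := exists_mdeg0 d D0.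
(* A point of [Z] provides [D.-1 <= N], needed for the dimension count with truncated
   subtraction. *)
have [[z1 /loc[_ [_ [_ [DN _ _]]]]]|Z0] := pselect (exists z, Z z); last first.
  apply: lebesgue_null_sub (lebesgue_null0 i0).
  by move=> y [z Zz _]; apply: Z0; exists z.
pose co (z : 'rV[R]_N * ('rV[R]_d * 'rV[R]_d)) (k : 'I_(N + (d + d))) : R :=
  row_mx z.1 (row_mx z.2.1 z.2.2) 0 k.
have coB z z' k : co z k - co z' k =
    row_mx (z.1 - z'.1) (row_mx (z.2.1 - z'.2.1) (z.2.2 - z'.2.2)) 0 k.
  by rewrite /co row_mxB opp_row_mx add_row_mx.
apply: (@lebesgue_null_local_lipschitz_graph _ _ i0 _ _ _ co
  (fun z => param z.1) (N - D.-1 + (d + d))%N).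
  (* The count [N - (D - 1) + 2d < N] amounts to [2d < D - 1], which follows from [4d <= D] and
     [0 < d]. *)
  rewrite -/N; lia.
move=> z0 /loc[A [C [r [_ r0 rP]]]].
pose h (z : 'rV[R]_N * ('rV[R]_d * 'rV[R]_d)) (k : 'I_(N - D.-1 + (d + d))) : R :=
  row_mx (z.1 *m A) (row_mx z.2.1 z.2.2) 0 k.
have hB z z' k : h z k - h z' k =
    row_mx ((z.1 - z'.1) *m A) (row_mx (z.2.1 - z'.2.1) (z.2.2 - z'.2.2)) 0 k.
  by rewrite /h row_mxB mulmxBl opp_row_mx add_row_mx.
have [K K0 KP] := mulmx_norm_le A.
(* Points within [r / 2] of [z0] are within [r] of each other; this bounds the part through [A] by
   [K * r] and the two remaining blocks by [r] each. The factor 2 counts the two terms of the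
   estimate, each at most [t]. *)
exists (r / 2), h, (K * r + (r + r)), (`|C| * 2); split; first by rewrite divr_gt0.
move=> z z' Zz Zz' zr zr'.
have near y : Z y -> (forall k, `|co y k - co z0 k| < r / 2) ->
    `|y - z0| <= r / 2.
  move=> Zy yr.
  have r20 : 0 <= r / 2 by rewrite divr_ge0// ltW.
  have [|y1 y2] := norm_row_mx_le r20 (a := y.1 - z0.1)
      (b := row_mx (y.2.1 - z0.2.1) (y.2.2 - z0.2.2)).
    by move=> k; rewrite -coB ltW.
  have [|y3 y4] := norm_row_mx_le r20 (a := y.2.1 - z0.2.1) (b := y.2.2 - z0.2.2).
    by move=> k; apply: le_trans y2; exact: coord_le_norm.
  by rewrite !prod_normE !ge_max y1 y3 y4.
have Nz : nearby Z z0 r z.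
  by split=> //; apply: le_lt_trans (near z Zz zr) _; rewrite ltr_pdivrMr//; lra.
have Nz' : nearby Z z0 r z'.
  by split=> //; apply: le_lt_trans (near z' Zz' zr') _; rewrite ltr_pdivrMr//; lra.
have zz : `|z - z'| <= r.
  rewrite [r]splitr -[z - z'](subrKA z0) (le_trans (ler_normD _ _))// lerD ?near//.
  by rewrite distrC near.
split=> [k|t t0 ht i].
  rewrite hB (le_trans (coord_le_norm _ _))// (le_trans (row_mx_norm_le _ _))//.
  rewrite lerD//.
    rewrite (le_trans (KP _))// ler_wpM2l ?(ltW K0)//.
    exact: le_trans (normr_fst_le (z - z')) zz.
  rewrite (le_trans (row_mx_norm_le _ _))// lerD//.
    exact: le_trans (normr_fst_le (z - z').2) (le_trans (normr_snd_le (z - z')) zz).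
  exact: le_trans (normr_snd_le (z - z').2) (le_trans (normr_snd_le (z - z')) zz).
have [|t1 t2] := norm_row_mx_le t0 (a := (z.1 - z'.1) *m A)
    (b := row_mx (z.2.1 - z'.2.1) (z.2.2 - z'.2.2)).
  by move=> k; rewrite -hB.
have [|t3 t4] := norm_row_mx_le t0 (a := z.2.1 - z'.2.1) (b := z.2.2 - z'.2.2).
  by move=> k; apply: le_trans t2; exact: coord_le_norm.
have t5 : `|z.2 - z'.2| <= t by rewrite prod_normE ge_max t3 t4.
have := coord_le_norm (z.1 - z'.1) (enum_rank i); rewrite !mxE => /le_trans; apply.
apply: (le_trans (rP z z' Nz Nz')).
apply: (@le_trans _ _ (`|C| * (`|(z.1 - z'.1) *m A| + `|z.2 - z'.2|))).
  by rewrite ler_wpM2r ?addr_ge0// ler_norm.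
by rewrite -mulrA ler_wpM2l// mulr_natl mulr2n lerD.
Qed.
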